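(* Let $L,R$ be a partition of $[n]$ and let ${\bf d}=(d_1,\ldots,d_n)$ be a vector of nonnegative integers with $\sum_{i=1}^n d_i$ even, $d_{\max}=o(M({\bf d})^{1/4})$ and $M_1({\bf d},R)\ge M_1({\bf d},L)$. Then, uniformly over all $L$ and ${\bf d}$, as $n\to\infty$, $$g(L,R,{\bf d})=\frac{M_1({\bf d},R)!\,e^{-\mu_0({\bf d})-\mu_1({\bf d})-\mu_2({\bf d})}}{2^{(M_1({\bf d},R)-M_1({\bf d},L))/2}\big((M_1({\bf d},R)-M_1({\bf d},L))/2\big)!\prod_{i=1}^n d_i!}\left(1+O\left(\frac{d_{\max}^4}{M({\bf d})}\right)\right).$$
   Context: A B-graph with vertex bipartition $(L,R)$ is a simple graph on vertex set $L\cup R$ (here $L\cup R=[n]$) in which $L$ is an independent set. $g(L,R,{\bf d})$ is the number of B-graphs with vertex bipartition $(L,R)$ in which vertex $i$ has degree $d_i$ for every $i\in[n]$. Notation: $M({\bf d})=\sum_{i=1}^n d_i$, $d_{\max}=\max_i d_i$; for $S\subseteq[n]$, $M_1({\bf d},S)=\sum_{i\in S}d_i$ and $M_2({\bf d},S)=\sum_{i\in S}d_i(d_i-1)$; $\mu_0({\bf d})=\frac{(M_1({\bf d},R)-M_1({\bf d},L))M_2({\bf d},R)}{2M_1({\bf d},R)^2}$, $\mu_1({\bf d})=\frac{M_2({\bf d},R)M_2({\bf d},L)}{2M_1({\bf d},R)^2}$, $\mu_2({\bf d})=\mu_0({\bf d})^2$. ''Uniformly'' means the constant implicit in $O(\cdot)$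 depends only on the function implicit in the $o(\cdot)$ hypothesis, not on the particular choice of $L$ and ${\bf d}$. *)

(* Defs.v *)
From mathcomp Require Import all_boot all_order all_algebra.
From mathcomp Require Import all_classical all_reals all_analysis.
Set Implicit Arguments.
Unset Strict Implicit.
Unset Printing Implicit Defensive.
Import Order.TTheory GRing.Theory Num.Theory.
Import numFieldNormedType.Exports.

(* A graph on the vertex set 'I_n is given by its edge set, so that labelled
   simple graphs are counted by the cardinality of a set of edge sets. *)
Definition simple_graph (n : nat) (E : {set {set 'I_n}}) : bool :=
  [forall e in E, #|e| == 2].

Definition degree (n : nat) (E : {set {set 'I_n}}) (v : 'I_n) : nat :=
  #|[set e in E | v \in e]|.

Definition independent (n : nat) (E : {set {set 'I_n}}) (L : {set 'I_n}) :
  bool := [forall x in L, forall y in L, [set x; y] \notin E].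

(* Either part may be empty; finset's [partition] would exclude this. *)
Definition bipartition (n : nat) (L R : {set 'I_n}) : bool :=
  [disjoint L & R] && (L :|: R == [set: 'I_n]).

Definition B_graph (n : nat) (L R : {set 'I_n}) (E : {set {set 'I_n}}) :
  bool := [&& bipartition L R, simple_graph E & independent E L].

Definition g (n : nat) (L R : {set 'I_n}) (d : 'I_n -> nat) : nat :=
  #|[set E : {set {set 'I_n}} |
      B_graph L R E && [forall i, degree E i == d i]]|.

Definition M (n : nat) (d : 'I_n -> nat) : nat := \sum_(i < n) d i.

Definition dmax (n : nat) (d : 'I_n -> nat) : nat := \max_(i < n) d i.

Definition M1 (n : nat) (d : 'I_n -> nat) (S : {set 'I_n}) : nat :=
  \sum_(i in S) d i.

Definition M2 (n : nat) (d : 'I_n -> nat) (S : {set 'I_n}) : nat :=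
  \sum_(i in S) d i * (d i - 1).

Local Open Scope ring_scope.

(* For a bipartition with M1 d L <= M1 d R, the denominators of mu0 and mu1
   vanish only if d = 0, and then x / 0 = 0 gives the intended value 0. *)
Definition mu0 (F : realType) (n : nat) (L R : {set 'I_n})
    (d : 'I_n -> nat) : F :=
  ((M1 d R)%:R - (M1 d L)%:R) * (M2 d R)%:R / (2 * (M1 d R)%:R ^+ 2).

Definition mu1 (F : realType) (n : nat) (L R : {set 'I_n})
    (d : 'I_n -> nat) : F :=
  (M2 d R)%:R * (M2 d L)%:R / (2 * (M1 d R)%:R ^+ 2).

Definition mu2 (F : realType) (n : nat) (L R : {set 'I_n})
    (d : 'I_n -> nat) : F := mu0 F L R d ^+ 2.

(* The subtraction and the halving in h are exact for a bipartition with
   M1 d L <= M1 d R and M d even. *)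
Definition main_term (F : realType) (n : nat) (L R : {set 'I_n})
    (d : 'I_n -> nat) : F :=
  let h := (M1 d R - M1 d L)./2%N in
  ((M1 d R)`!)%:R * expR (- mu0 F L R d - mu1 F L R d - mu2 F L R d)
  / (2 ^+ h * (h`!)%:R * \prod_(i < n) ((d i)`!)%:R).

(* Main.v *)
(* Give every vertex [v] of [R] and [L] its [d v] points, and add [h = (M1 R - M1 L) / 2] slots with two
   points each. A bijection from the [N = M1 R] points of [R] to the points of [L] and of the slots
   describes a multigraph in which [L] is independent, a slot standing for an edge inside [R]. Every
   simple graph arises from exactly [2^h h! prod d_i!] bijections, so it remains to show that a uniform
   random bijection is simple with probability [exp (- mu0 - mu1 - mu2) (1 + O (dmax^4 / N))].
   Non-simplicity means containing one of a family of partial bijections of size 2 (a loop or a double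
   edge to [L]) or 4 (a double edge inside [R]). Add these to the forbidden set one at a time. The
   conditional probability of the next one is its unconditional probability [p] times
   [1 + O (dmax^2 / N)]: the upper bound is the lopsided Lovasz local lemma for random permutations, the
   lower bound a transposition switching whose failures are controlled by that upper bound. Since the
   [p] add up to [mu0 + mu1 + mu2 + O (dmax^4 / N)], which is [O (dmax^2)], the product of the factors
   [1 - p (1 + O (dmax^2 / N))] is as claimed. *)

Require Import Defs.
From mathcomp Require Import all_boot all_order all_algebra.
From mathcomp Require Import all_classical all_reals all_analysis.
From mathcomp Require Import fintype finset fingroup perm zify ring lra.
Set Implicit Arguments.
Unset Strict Implicit.
Unset Printing Implicit Defensive.
Import Order.TTheory GRing.Theory Num.Theory.
Import numFieldNormedType.Exports.

(** * Switchings of permutations *)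

(** The expected number of forbidden patterns may be of order [dmax ^ 2], hence unbounded. The
    probability of simplicity may then tend to 0, and an estimate with additive error would be
    worthless. This forces conditional probabilities with relative error, multiplied over all
    patterns. The abstract part sees the patterns mainly through [FF_sparse]: once a nonempty part
    of a pattern is present, its completions have mass at most [eta], of order [dmax ^ 2 / N].
    Summed over single entries this also bounds the total mass by [N * eta], so the accumulated
    error [eta * (N * eta)] is of order [dmax ^ 4 / N]. In the lower bound a switching can fail by
    completing a pattern through the prescribed entry or through the other new entry. Patterns of
    the first kind are tied to the prescribed entries and have mass of order [eta]. Those of the
    second kind can lie anywhere, with mass of order [N * eta], but the permutation before the
    switching must then contain one entry more than the pattern lacks, and this entry brings back a
    factor [1 / N]. *)

Lemma leq_card_bigcup (I U : finType) (P : pred I) (A : I -> {set U}) :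
  (#|\bigcup_(i | P i) A i| <= \sum_(i | P i) #|A i|)%N.
Proof.
elim/big_ind2: _ => [|m A1 n A2 h1 h2|//]; first by rewrite cards0.
exact: leq_trans (leq_card_setU _ _).1 (leq_add h1 h2).
Qed.

Section Switching.
Variable T : finType.
Implicit Types (s : {perm T}) (G F : {set T * T}) (S : {set {set T * T}}).

Definition contains s G := [forall p in G, s p.1 == p.2].
Definition avoiders S : {set {perm T}} := [set s | [forall F in S, ~~ contains s F]].
Definition avoid_through S G : nat := #|[set s in avoiders S | contains s G]|.

(** An entry of [G] and an entry of [F] are either equal or share neither row nor column. In
    particular [compat F F] says that [F] is the graph of a partial injection. *)
Definition compat G F :=
  [forall p in G, forall q in F, (p.1 == q.1) == (p.2 == q.2)].

Lemma containsP s G : reflect (forall a c, (a, c) \in G -> s a = c) (contains s G).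
Proof.
apply: (iffP forall_inP) => [h a c /h /eqP //|h [a c] /h /= -> //].
Qed.

Lemma containsU1 s a c G : contains s ((a, c) |: G) = (s a == c) && contains s G.
Proof.
apply/containsP/andP => [h|[/eqP h1 /containsP h2] x y].
  split; first by apply/eqP/h; rewrite !inE eqxx.
  by apply/containsP => x y xy; apply: h; rewrite !inE xy orbT.
by rewrite !inE => /orP[/eqP[-> ->] //|/h2].
Qed.

Lemma containsU s G G' : contains s (G :|: G') = contains s G && contains s G'.
Proof.
apply/containsP/andP => [h|[/containsP h1 /containsP h2] x y].
  by split; apply/containsP => x y xy; apply: h; rewrite !inE xy ?orbT.
by rewrite !inE => /orP[/h1|/h2].
Qed.

Lemma compatP G F : reflect
  (forall a c x y, (a, c) \in G -> (x, y) \in F -> (a == x) = (c == y)) (compat G F).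
Proof.
apply: (iffP forall_inP) => [h a c x y ac xy|h [a c] ac].
  by have /forall_inP /(_ _ xy) /eqP := h _ ac.
by apply/forall_inP => -[x y] xy; apply/eqP/h.
Qed.

Lemma compat_subl G G' F : G \subset G' -> compat G' F -> compat G F.
Proof.
move=> /subsetP sub /compatP h; apply/compatP => a c x y /sub; exact: h.
Qed.

Lemma avoidersP S s : reflect (forall F, F \in S -> ~~ contains s F) (s \in avoiders S).
Proof. by rewrite inE; apply: (iffP forall_inP). Qed.

Lemma avoiders_sub S S' : S' \subset S -> avoiders S \subset avoiders S'.
Proof.
move=> /subsetP sub; apply/subsetP => s /avoidersP h.
by apply/avoidersP => F /sub /h.
Qed.

Lemma avoid_through_sub S S' G : S' \subset S -> (avoid_through S G <= avoid_through S' G)%N.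
Proof.
move=> /avoiders_sub sub; apply/subset_leq_card.
rewrite !setIdE; exact: setSI.
Qed.

Lemma avoid_through0 S : avoid_through S finset.set0 = #|avoiders S|.
Proof.
rewrite /avoid_through; apply: eq_card => s; rewrite [LHS]inE.
by case: (_ \in _) => //=; apply/containsP => a c; rewrite inE.
Qed.

Lemma avoiders_set0 : #|avoiders finset.set0| = (#|T|)`!.
Proof.
rewrite -[#|T|]cardsT -card_perm; apply: eq_card => s.
have -> : s \in avoiders finset.set0 by apply/avoidersP => F; rewrite inE.
by apply/esym/subsetP => x _; rewrite inE.
Qed.

Lemma card_not_rows G : (#|T| - #|G| <= #|[set x | x \notin [set p.1 | p in G]]|)%N.
Proof.
by rewrite leq_subLR -(cardsC [set p.1 | p in G]) leq_add ?leq_imset_card.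
Qed.

(* Exchanging the images of [a] and [x] for a row [x] outside [G] gives a map that is injective in
   [(s, x)], since [x] is the new preimage of [c]. *)
Lemma avoid_through_switch S G a c : (a, c) \notin G ->
  (forall F, F \in S -> compat ((a, c) |: G) F) ->
  ((#|T| - #|G|) * avoid_through S ((a, c) |: G) <= avoid_through S G)%N.
Proof.
move=> acG cS.
pose A := [set s in avoiders S | contains s ((a, c) |: G)].
pose X := [set x | x \notin [set p.1 | p in G]].
pose f (z : {perm T} * T) := (tperm a z.2 * z.1)%g.
have sA s : s \in A -> [/\ s \in avoiders S, s a = c & contains s G].
  by rewrite inE containsU1 => /and3P[-> /eqP -> ->].
apply: (@leq_trans #|f @: setX A X|); last first.
  apply/subset_leq_card/subsetP => _ /imsetP[[s x] /setXP[/sA[sav sac sG] xX] ->].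
  have fG : contains (f (s, x)) G.
    apply/containsP => b e be; rewrite permM /=.
    have ba : b <> a.
      move=> ba; rewrite {}ba in be; move: (containsP _ _ sG _ _ be).
      by rewrite sac => ce; rewrite -ce (negPf acG) in be.
    have bx : b <> x.
      move=> bx; move: xX; rewrite inE => /imsetP; apply.
      by exists (b, e).
    by rewrite tpermD; [exact: (containsP _ _ sG)|exact/eqP/nesym|exact/eqP/nesym].
  (* By compatibility the only entry of [F] in row [a] or column [c] can be [(a, c)], which [s] has.
     On all its other entries the two permutations agree, so [F] would already lie in [s]. *)
  rewrite inE fG andbT; apply/avoidersP => F FS; apply/negP => fF.
  move/avoidersP/(_ _ FS)/negP: (sav); apply; apply/containsP => b e be.
  have := containsP _ _ fF _ _ be; rewrite permM /=.
  have cpt := compatP _ _ (cS _ FS) a c b e (setU11 _ _) be.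
  case: tpermP => [bE|bE|_ _ //]; last first.
    rewrite sac => ce; rewrite ce eqxx in cpt.
    by rewrite -(eqP cpt) sac.
  by move=> _; rewrite bE eqxx in cpt; rewrite bE sac; apply/eqP.
rewrite card_in_imset; first by rewrite cardsX mulnC leq_mul2l card_not_rows orbT.
move=> [s x] [s' x'] /setXP[/sA[_ sac _] _] /setXP[/sA[_ sac' _] _] ff.
have xx' : x = x'.
  apply: (@perm_inj _ (f (s, x))); rewrite {2}ff !permM /= !tpermR.
  by rewrite sac sac'.
rewrite xx' in ff *; congr pair.
exact: (mulgI (tperm a x')).
Qed.

(** Removing the entries of [G] one at a time collects the factors of the falling factorial. Thus
    avoiding patterns that do not clash with [G] can only lower the probability of [G], which is the
    negative dependence needed for the lopsided local lemma. *)
Lemma avoid_through_compat S G : (forall F, F \in S -> compat G F) ->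
  (#|T| ^_ #|G| * avoid_through S G <= #|avoiders S|)%N.
Proof.
have [k] := ubnP #|G|; elim: k G => // k IH G; rewrite ltnS => Gk cS.
have [->|] := eqVneq G finset.set0; first by rewrite cards0 ffactn0 mul1n avoid_through0.
case/set0Pn => -[a c] acG.
have GE := setD1K acG; have acG' : (a, c) \notin G :\ (a, c) by rewrite !inE eqxx.
have cG : #|G| = #|G :\ (a, c)|.+1 by rewrite (cardsD1 (a, c) G) acG.
rewrite cG ffactnSr -mulnA -[X in avoid_through _ X]GE.
apply: leq_trans (IH (G :\ (a, c)) _ _); first last.
- by move=> F /cS; apply: compat_subl; apply: subD1set.
- by rewrite -ltnS -cG.
rewrite leq_mul2l; apply/orP; right.
by apply: avoid_through_switch => // F; rewrite GE; apply: cS.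
Qed.


Lemma card_avoiders_union S S' : S' \subset S ->
  (#|avoiders S'| <= #|avoiders S| + \sum_(F in S :\: S') avoid_through S' F)%N.
Proof.
move=> sub.
apply: (@leq_trans #|avoiders S :|: \bigcup_(F in S :\: S') [set s in avoiders S' | contains s F]|).
  apply/subset_leq_card/subsetP => s sS'; rewrite inE.
  have [//|sS /=] := boolP (s \in avoiders S).
  move: sS; rewrite inE negb_forall_in => /exists_inP[F FS]; rewrite negbK => sF.
  apply/bigcupP; exists F; last by rewrite inE sS' sF.
  rewrite inE FS andbT; apply/negP => FS'.
  by move/avoidersP/(_ _ FS'): sS'; rewrite sF.
apply: leq_trans (leq_card_setU _ _).1 _; rewrite leq_add2l.
exact: leq_card_bigcup.
Qed.

(** What a permutation contains before a switching that completes [F] through [(x, y)]: the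
    switching turns [(a, y)] and [(x, c)] into [(a, c)] and [(x, y)] and leaves the other entries
    alone. *)
Definition clash_pattern G B F (a c x y : T) : {set T * T} :=
  G :|: ((a, y) |: ((x, c) |: (F :\: B) :\ (x, y))).

(** The single entry [(x, y)] of [F] is replaced by two, so there is one entry more than in [G]
    together with [F :\: B]. This surplus is the source of the extra factor [1 / N]. *)
Lemma card_clash_pattern G F a c x y : let B := (a, c) |: G in
  compat B B -> compat F F -> (x, y) \in F :\: B -> x != a -> y != c ->
  #|clash_pattern G B F a c x y| = (#|G| + #|F :\: B|.+1)%N.
Proof.
move=> B /compatP cB /compatP cF xyFB xa yc.
have acB : (a, c) \in B by rewrite !inE eqxx.
have sG p : p \in G -> p \in B by rewrite !inE => ->; rewrite orbT.
have xyF : (x, y) \in F by move: xyFB; rewrite inE => /andP[].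
have ayF : (a, y) \notin F.
  by apply/negP => h; move: (cF _ _ _ _ h xyF); rewrite eqxx eq_sym (negPf xa).
have xcF : (x, c) \notin F.
  by apply/negP => h; move: (cF _ _ _ _ h xyF); rewrite eqxx eq_sym (negPf yc).
have ayG : (a, y) \notin G.
  by apply/negP => /sG h; move: (cB _ _ _ _ h acB); rewrite eqxx (negPf yc).
have xcG : (x, c) \notin G.
  by apply/negP => /sG h; move: (cB _ _ _ _ h acB); rewrite eqxx (negPf xa).
rewrite cardsU disjoint_setI0 ?cards0 ?subn0; last first.
  rewrite disjoint_sym disjoint_subset; apply/subsetP => p; rewrite !inE.
  case/or3P => [/eqP -> //|/eqP -> //|/and3P[_ + _]].
  by rewrite negb_or => /andP[].
rewrite cardsU1 !inE !negb_or cardsU1 !inE (negPf ayF) (negPf xcF) !andbF.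
rewrite xpair_eqE (eq_sym a x) (negPf xa) /= [#|F :\: B|](cardsD1 (x, y)) xyFB.
by rewrite !add1n addnS.
Qed.

(* Rerouting [a] to [c], and the former preimage of [c] to the former image of [a], is at most
   [(#|T| - #|G|)]-to-one. It creates an element [F] of [S] only if [F] uses one of the two new
   entries: [(a, c)] (first sum) or the other one, [(x, y)] (second sum). *)
Lemma avoid_through_switch_back S G a c : let B := (a, c) |: G in
  (a, c) \notin G -> compat B B -> (forall F, F \in S -> compat F F) ->
  (avoid_through S G <= (#|T| - #|G|) * avoid_through S B
    + \sum_(F in S | (a, c) \in F) avoid_through S (G :|: F :\: B)
    + \sum_(F in S) \sum_(p in F :\: B | (p.1 != a) && (p.2 != c))
         avoid_through S (clash_pattern G B F a c p.1 p.2))%N.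
Proof.
move=> B acG cB cS.
have acB : (a, c) \in B by rewrite !inE eqxx.
have sG p : p \in G -> p \in B by rewrite !inE => ->; rewrite orbT.
pose Phi s := (tperm a (s^-1 c) * s)%g.
pose X := [set x | x \notin [set p.1 | p in G]].
pose thr H := [set s in avoiders S | contains s H].
have PhiE s z : Phi s z = if z == a then c else if z == (s^-1)%g c then s a else s z.
  rewrite permM; have [->|za] := eqVneq z a; first by rewrite tpermL permKV.
  have [->|zx] := eqVneq z (s^-1 c)%g; first by rewrite tpermR.
  by rewrite tpermD // eq_sym.
have colX s : contains s G -> (s^-1)%g c \in X.
  move=> sG'; rewrite inE; apply/imsetP => -[[x e] xe /= xE].
  have ec : e = c by rewrite -(containsP _ _ sG' _ _ xe) -xE permKV.
  rewrite {}ec in xe.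
  by have := compatP _ _ cB _ _ _ _ (sG _ xe) acB; rewrite eqxx => /eqP xa; rewrite -xa xe in acG.
have cX : #|X| = (#|T| - #|G|)%N.
  have -> : #|G| = #|[set p.1 | p in G]|.
    rewrite card_in_imset // => -[x y] [x' y'] /sG h /sG h' /= xx'.
    have := compatP _ _ cB _ _ _ _ h h'; rewrite xx' eqxx => /esym /eqP ->.
    by [].
  rewrite -(cardsC [set p.1 | p in G]) addKn; apply: eq_card => x.
  by rewrite !inE.
have PhiG s : s \in thr G -> contains (Phi s) B.
  rewrite inE => /andP[_ sG']; rewrite containsU1 PhiE eqxx eqxx /=.
  apply/containsP => x e xe; rewrite PhiE.
  case: eqP => [xa|_].
    rewrite xa in xe; have := compatP _ _ cB _ _ _ _ (sG _ xe) acB.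
    by rewrite eqxx => /esym /eqP.
  case: eqP => [xE|_]; last exact: (containsP _ _ sG').
  by have := colX _ sG'; rewrite inE => /imsetP[]; exists (x, e).
apply: (@leq_trans (#|[set s in thr G | Phi s \in avoiders S]|
    + #|\bigcup_(F in S | (a, c) \in F) thr (G :|: F :\: B)|
    + #|\bigcup_(F in S) \bigcup_(p in F :\: B | (p.1 != a) && (p.2 != c))
       thr (clash_pattern G B F a c p.1 p.2)|)%N); last first.
  apply: leq_add; first apply: leq_add.
  - have inj : {in [set s in thr G | Phi s \in avoiders S] &,
        injective (fun s => (Phi s, (s^-1)%g c))}.
      by move=> s s' _ _ [+ E]; rewrite /Phi E => /mulgI.
    rewrite -(card_in_imset inj) -cX mulnC -cardsX.
    apply/subset_leq_card/subsetP => _ /imsetP[s + ->].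
    rewrite inE => /andP[sG' sP]; apply/setXP; split.
      by rewrite inE sP PhiG.
    by apply: colX; move: sG'; rewrite inE => /andP[].
  - exact: leq_card_bigcup.
  - apply: leq_trans (@leq_card_bigcup _ _ _ _) _.
    apply: leq_sum => F _; exact: leq_card_bigcup.
apply: leq_trans _ (leq_add (leq_card_setU _ _).1 (leqnn _)).
apply: leq_trans _ (leq_card_setU _ _).1.
apply/subset_leq_card/subsetP => s sG'; rewrite !in_setU.
rewrite [s \in [set _ in _ | _]]inE sG' /=.
have [//|] := boolP (Phi s \in avoiders S).
rewrite inE negb_forall_in => /exists_inP[F FS]; rewrite negbK => PF /=.
move: (sG'); rewrite inE => /andP[sav sG''].
set x := (s^-1)%g c in PhiE; set y := s a.
have sx : s x = c by rewrite permKV.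
have xa : x != a.
  apply/eqP => xa; move/avoidersP/(_ _ FS)/negP: sav; apply.
  by move: PF; rewrite /Phi -/x xa tperm1 mul1g.
have yc : y != c by apply: contra xa => /eqP yc; apply/eqP/(@perm_inj _ s); rewrite sx.
have PF' u v : (u, v) \in F -> u != a -> u != x -> s u = v.
  by move=> uv ua ux; rewrite -(containsP _ _ PF _ _ uv) PhiE (negPf ua) (negPf ux).
have PFB u v : (u, v) \in F -> (u, v) \notin B -> u != a.
  move=> uv uvB; apply/eqP => ua; move: (containsP _ _ PF _ _ uv).
  by rewrite PhiE ua eqxx => cv; rewrite -cv ua acB in uvB.
(* The only entries of [Phi s] that [s] lacks are [(a, c)] and [(x, y)], so [F] uses one of them. *)
have [xyF|xyF] := boolP ((x, y) \in F).
  apply/orP; right; apply/bigcupP; exists F => //.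
  have xyB : (x, y) \notin B.
    rewrite !inE xpair_eqE negb_or (negPf xa) /=; apply/negP => xyG.
    by move/containsP: sG'' => /(_ _ _ xyG) sxy; rewrite -sxy sx eqxx in yc.
  apply/bigcupP; exists (x, y); first by rewrite !inE xyF xa yc -in_setU1 -/B xyB.
  rewrite inE sav /clash_pattern containsU sG'' /= !containsU1 /= eqxx sx eqxx /=.
  apply/containsP => u v; rewrite in_setD1 in_setD => /and3P[uvxy uvB uv].
  apply: PF' => //; first exact: PFB uv uvB.
  apply: contra uvxy => /eqP ux; apply/eqP; congr pair => //.
  by move: (containsP _ _ PF _ _ uv); rewrite PhiE ux (negPf xa) eqxx.
have uvx u v : (u, v) \in F -> u != x.
  move=> uv; apply/eqP => ux; move: (containsP _ _ PF _ _ uv).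
  by rewrite PhiE ux (negPf xa) eqxx -/y => yv; rewrite yv -ux uv in xyF.
have acF : (a, c) \in F.
  apply/negP => acF; move/avoidersP/(_ _ FS)/negP: sav; apply.
  apply/containsP => u v uv; apply: PF' => //; last exact: uvx uv.
  apply/eqP => ua; apply: acF; move: (containsP _ _ PF _ _ uv).
  by rewrite PhiE ua eqxx => ->; rewrite -ua.
apply/orP; left; apply/bigcupP; exists F; first by rewrite FS acF.
rewrite inE sav containsU sG'' /=; apply/containsP => u v.
rewrite in_setD => /andP[uvB uv]; apply: PF' => //; last exact: uvx uv.
exact: PFB uv uvB.
Qed.

End Switching.

(** * A local lemma with matching upper bound *)

Lemma set1_nonempty (U : finType) (x : U) : [set x]%SET != finset.set0.
Proof. by rewrite -card_gt0 cards1. Qed.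

(** Here [1 + 64 * 16 * e] is the relative error factor of the upper bound, and [q] the resulting
    conditional probability. The larger constant on the right absorbs the loss in passing from
    [1 - q] to an exponential. *)
Lemma rate_slack (R : realFieldType) (e q : R) : (0 <= e -> 64 * 16 * e <= 1 -> q <= 2 * e ->
  1 + 64 * 16 * e <= (1 + 4 * 80 * 64 * e) * (1 - q))%R.
Proof.
move=> e0 e1 qe.
have e4 : (0 <= e * (2 * e - q))%R by rewrite mulr_ge0 // subr_ge0.
have e5 : (0 <= e * (1 - 64 * 16 * e))%R by rewrite mulr_ge0 // subr_ge0.
nra.
Qed.

Ltac nlia :=
  repeat match goal with
  | H : is_true (leq ?a ?b) |- _ =>
    lazymatch goal with |- context [leq a b] => fail | _ => generalize H end
  | H : @eq nat ?a ?b |- _ =>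
    lazymatch goal with |- context [@eq nat a b] => fail | _ => generalize H end
  end; clear; intros; lia.

Section LocalLemma.
Variables (R : realType) (T : finType) (FF : {set {set T * T}}) (eta : R).
Local Open Scope ring_scope.
Implicit Types (G F B Q : {set T * T}) (S : {set {set T * T}}).

Let N := #|T|.
Let iN : R := N%:R^-1.
(** The probability that a uniform random permutation contains a given partial injection with [k]
    entries. *)
Definition pr (k : nat) : R := (#|T| ^_ k)%:R^-1.

Hypothesis N16 : (16 <= #|T|)%N.
Hypothesis FF_size : forall F, F \in FF -> (2 <= #|F| <= 4)%N.
Hypothesis FF_inj : forall F, F \in FF -> compat F F.
(** If a new pattern contained one that is already avoided, its conditional probability would be 0
    and no lower bound could hold. *)
Hypothesis FF_antichain : forall F F', F \in FF -> F' \in FF -> F \subset F' -> F = F'.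
(* Up to a constant, the sum is the expected number of elements of [FF] completing [Q], given [Q]. *)
Hypothesis FF_sparse : forall Q, Q != finset.set0 ->
  \sum_(F in FF | Q \proper F) (#|T|%:R^-1) ^+ (#|F| - #|Q|) <= eta.
Hypothesis eta_small : 64 * 16 * eta <= 1.

Let N_gt0 : 0 < N%:R :> R. Proof. by rewrite ltr0n /N; nlia. Qed.
Let iN_gt0 : 0 < iN. Proof. by rewrite invr_gt0. Qed.
Let NiN : N%:R * iN = 1. Proof. by rewrite mulfV // gt_eqF. Qed.
Let iN16 : iN <= 16^-1.
Proof. by rewrite lef_pV2 ?posrE // ler_nat. Qed.
Let iN_le1 : iN <= 1. Proof. by apply: le_trans iN16 _; lra. Qed.

Let eta_ge0 : 0 <= eta.
Proof.
have /card_gt0P[x _] : (0 < #|T|)%N by nlia.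
apply: le_trans (FF_sparse (set1_nonempty (x, x))); apply: sumr_ge0 => F _.
by rewrite exprn_ge0 // ltW.
Qed.

Lemma pr_gt0 k : (k <= 16)%N -> 0 < pr k.
Proof. by move=> k16; rewrite invr_gt0 ltr0n ffact_gt0; nlia. Qed.

Lemma prS k : (k < 16)%N -> pr k = (N - k)%:R * pr k.+1.
Proof.
move=> k16; rewrite /pr ffactnSr natrM invfM mulrCA mulfV ?mulr1 //.
by rewrite pnatr_eq0 /N; nlia.
Qed.

(** With at most 8 images fixed and [N >= 16], each further image still has at least [N / 2]
    possible values. *)
Lemma pr_add k r : (k + r <= 9)%N -> pr (k + r) <= pr k * (2 * iN) ^+ r.
Proof.
elim: r => [|r IH] kr; first by rewrite addn0 expr0 mulr1.
rewrite addnS exprSr mulrA; apply: (@le_trans _ _ (pr (k + r) * (2 * iN))); last first.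
  rewrite ler_wpM2r //; first by rewrite mulr_ge0 // ltW.
  by apply: IH; nlia.
rewrite (@prS (k + r)) //; last by nlia.
rewrite mulrAC ler_peMl //; first by apply/ltW/pr_gt0; nlia.
rewrite natrB; last by rewrite /N; nlia.
have : (k + r)%:R <= 8 :> R by rewrite (ler_nat _ _ 8); nlia.
have : iN <= 16^-1 by [].
have := NiN; have := iN_gt0; set m : R := (k + r)%:R; set n : R := N%:R.
move=> h1 h2 h3 h4; nra.
Qed.

Lemma pr_le k : (k <= 9)%N -> pr k <= (2 * iN) ^+ k.
Proof.
move=> k9; have := @pr_add 0 k k9.
by rewrite add0n /pr ffactn0 invr1 mul1r.
Qed.

Lemma expr2iN r : (r <= 4)%N -> (2 * iN) ^+ r <= 16 * iN ^+ r.
Proof.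
move=> r4; rewrite exprMn ler_pM2r ?exprn_gt0 //.
by rewrite -natrX ler_nat (@leq_pexp2l 2 r 4).
Qed.

Let w F := iN ^+ #|F|.
Let w_ge0 F : 0 <= w F. Proof. by rewrite exprn_ge0 // ltW. Qed.

Lemma mass_through (q : T * T) : \sum_(F in FF | q \in F) w F <= iN * eta.
Proof.
apply: le_trans (ler_wpM2l (ltW iN_gt0) (FF_sparse (set1_nonempty q))).
rewrite mulr_sumr le_eqVlt; apply/orP; left; apply/eqP.
apply: eq_big => [F|F /andP[FFF qF]].
  apply: andb_id2l => FFF; rewrite properEcard sub1set cards1.
  by case/andP: (FF_size FFF) => -> _; rewrite andbT.
rewrite cards1 -/N -/iN -exprS /w; congr (_ ^+ _).
by case/andP: (FF_size FFF); nlia.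
Qed.

Lemma mass_hit (P : pred {set T * T}) (Z : {set T * T}) :
  (forall F, F \in FF -> P F -> exists2 q, q \in Z & q \in F) ->
  \sum_(F in FF | P F) w F <= #|Z|%:R * (iN * eta).
Proof.
move=> h; apply: (@le_trans _ _ (\sum_(q in Z) \sum_(F in FF | q \in F) w F)).
  under [leRHS]eq_bigr do rewrite big_mkcondr.
  rewrite exchange_big big_mkcondr /=; apply: ler_sum => F FFF.
  case: ifP => [PF|_]; last by rewrite sumr_ge0 // => q _; case: ifP.
  have [q qZ qF] := h _ FFF PF; rewrite (bigD1 q) //= qF lerDl sumr_ge0 // => q' _.
  by case: ifP.
apply: (@le_trans _ _ (\sum_(q in Z) iN * eta)).
  by apply: ler_sum => q _; apply: mass_through.
by rewrite sumr_const mulr_natl.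
Qed.

(** Each of the [N ^ 2] entries carries mass at most [eta / N]. For [eta] of order [D ^ 2 / N] the
    result has order [D ^ 2], the same as the bound on the exponent of the final formula. *)
Lemma mass_all : \sum_(F in FF) w F <= N%:R * eta.
Proof.
have hit F : F \in FF -> predT F -> exists2 q, q \in [set: T * T] & q \in F.
  move=> FFF _; have /card_gt0P[q qF] : (0 < #|F|)%N by case/andP: (FF_size FFF); nlia.
  by exists q; rewrite ?inE.
have := mass_hit hit; rewrite cardsT card_prod natrM.
rewrite mulrA -[_ * _ * iN]mulrA NiN mulr1; apply: le_trans.
by under [leRHS]eq_bigl do rewrite andbT.
Qed.

(** At most [8 * 2 * N] entries share a row or column with a set of 8 entries, and each carries mass
    [eta / N]. The other factor 16 is the price of replacing [pr] by powers of [1 / N]. *)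
Let kappa : R := 16 * 16 * eta.

Lemma conflict_mass G : (#|G| <= 8)%N ->
  \sum_(F in FF | ~~ compat G F) pr #|F| <= kappa.
Proof.
move=> G8; pose Z := \bigcup_(p in G) ([set q | q.1 == p.1] :|: [set q | q.2 == p.2]).
have cZ : (#|Z| <= 16 * N)%N.
  apply: (@leq_trans (\sum_(p in G) (N + N))); last first.
    by rewrite sum_nat_const; nia.
  apply: leq_trans (leq_card_bigcup _ _) _; apply: leq_sum => p _.
  apply: leq_trans (leq_card_setU _ _).1 _; apply: leq_add.
    suff -> : [set q | q.1 == p.1] = setX [set p.1] [set: T] by rewrite cardsX cards1 cardsT mul1n.
    by apply/setP => q; rewrite !inE andbT.
  suff -> : [set q | q.2 == p.2] = setX [set: T] [set p.2] by rewrite cardsX cards1 cardsT muln1.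
  by apply/setP => q; rewrite !inE.
apply: (@le_trans _ _ (16 * \sum_(F in FF | ~~ compat G F) w F)).
  rewrite mulr_sumr; apply: ler_sum => F /andP[FFF _].
  by apply: le_trans (pr_le _) (expr2iN _); case/andP: (FF_size FFF); nlia.
have hit F : F \in FF -> ~~ compat G F -> exists2 q, q \in Z & q \in F.
  move=> _; rewrite negb_forall_in => /exists_inP[p pG]; rewrite negb_forall_in => /exists_inP[q qF pq].
  exists q => //; apply/bigcupP; exists p => //; move: pq; rewrite !inE (eq_sym p.1) (eq_sym p.2).
  by case: (q.1 == _); case: (q.2 == _).
have h := mass_hit hit; have : #|Z|%:R * (iN * eta) <= 16 * eta.
  rewrite mulrA ler_wpM2r //; apply: (@le_trans _ _ ((16 * N)%:R * iN)).
    by rewrite ler_pM2r // ler_nat.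
  by rewrite natrM -mulrA NiN mulr1.
rewrite /kappa; lra.
Qed.

(* Lopsided local lemma: patterns compatible with [G] only lower the probability of [G], and the
   clashing ones have total mass at most [kappa]. *)
Lemma avoid_through_le S G : S \subset FF -> (#|G| <= 8)%N ->
  (avoid_through S G)%:R <= (1 + 4 * kappa) * pr #|G| * #|avoiders S|%:R.
Proof.
have k0 : 0 <= kappa by rewrite mulr_ge0.
have k4 : kappa <= 4^-1 by have := eta_small; rewrite /kappa; lra.
(* Strong induction: the bound for [S] is reduced to its compatible part [S'], and the induction
   hypothesis for [S'] bounds the avoiders of [S'] lost by also avoiding the clashing patterns. *)
have [k] := ubnP #|S|; elim: k S G => // k IH S G; rewrite ltnS => Sk SFF G8.
pose S' := [set F in S | compat G F].
have S'S : S' \subset S by apply/subsetP => F; rewrite inE => /andP[].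
have prG : 0 < pr #|G| by apply: pr_gt0; nlia.
have h1 : (avoid_through S G)%:R <= pr #|G| * #|avoiders S'|%:R.
  apply: (@le_trans _ _ (avoid_through S' G)%:R); first by rewrite ler_nat avoid_through_sub.
  rewrite /pr mulrC ler_pdivlMr; last by rewrite ltr0n ffact_gt0; nlia.
  rewrite -natrM ler_nat mulnC; apply: avoid_through_compat => F.
  by rewrite inE => /andP[].
apply: le_trans h1 _; rewrite mulrAC mulrC ler_pM2r //.
have [SS'|nSS'] := eqVneq S' S; first by rewrite SS' ler_peMl //; lra.
have S'k : (#|S'| < k)%N.
  by apply: leq_trans Sk; rewrite proper_card // properEneq nSS'.
have : #|avoiders S'|%:R <= #|avoiders S|%:R + 2 * kappa * #|avoiders S'|%:R :> R.
  apply: (@le_trans _ _ (#|avoiders S| + \sum_(F in S :\: S') avoid_through S' F)%:R).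
    by rewrite ler_nat card_avoiders_union.
  rewrite natrD lerD2l natr_sum.
  apply: (@le_trans _ _ (\sum_(F in S :\: S') 2 * pr #|F| * #|avoiders S'|%:R)).
    apply: ler_sum => F; rewrite inE => /andP[_ FS].
    have /andP[F2 F4] := FF_size (subsetP SFF _ FS).
    apply: le_trans (IH S' F S'k _ _) _; [exact: subset_trans SFF|nlia|].
    rewrite ler_wpM2r // ler_wpM2r //; first by apply/ltW/pr_gt0; nlia.
    by move: k4; lra.
  rewrite -mulr_suml ler_wpM2r // -mulr_sumr ler_pM2l //.
  apply: le_trans (conflict_mass G8).
  rewrite [leRHS](bigID (mem S)) /= -[leLHS]addr0 lerD //; last first.
    rewrite sumr_ge0 // => F /andP[/andP[FFF _] _]; apply/ltW/pr_gt0.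
    by case/andP: (FF_size FFF) => _ /leq_trans; apply.
  rewrite le_eqVlt; apply/orP; left; apply/eqP/eq_bigl => F.
  rewrite !inE; case FS : (F \in S); rewrite ?andbF //= ?andbT ?(subsetP SFF _ FS) //.
have : 0 <= #|avoiders S'|%:R :> R by [].
have : 0 <= #|avoiders S|%:R :> R by [].
set u : R := #|avoiders S'|%:R; set v : R := #|avoiders S|%:R.
move=> v0 u0 h.
(* From [u <= v + 2 * kappa * u]; the product of [1 + 4 * kappa] and [1 - 2 * kappa] is at least 1
   because [kappa <= 1 / 4]. *)
have h1 : (1 + 4 * kappa) * (u - 2 * kappa * u) <= (1 + 4 * kappa) * v.
  by rewrite ler_wpM2l //; [move: k0; lra|lra].
have h2 : 0 <= kappa * (1 - 4 * kappa) * u by rewrite !mulr_ge0 //; move: k4; lra.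
apply: le_trans h1; rewrite -subr_ge0.
by have -> : (1 + 4 * kappa) * (u - 2 * kappa * u) - u = 2 * (kappa * (1 - 4 * kappa) * u); [ring|lra].
Qed.

(** The patterns are sorted by their trace [Q = F :&: B], for which [F :\: B] has [#|F| - #|Q|]
    elements. This brings the sum into the form of [FF_sparse]. *)
Lemma leq_ratio_mass B (P : pred {set T * T}) (Z : {set {set T * T}}) :
  (forall F, F \in FF -> P F -> ~~ (F \subset B) /\ F :&: B \in Z) ->
  \sum_(F in FF | P F) iN ^+ #|F :\: B|
    <= \sum_(Q in Z) \sum_(F in FF | Q \proper F) iN ^+ (#|F| - #|Q|).
Proof.
move=> h; under [leRHS]eq_bigr do rewrite big_mkcondr.
rewrite exchange_big big_mkcondr /=; apply: ler_sum => F FFF.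
have pos (b : bool) k : 0 <= (if b then iN ^+ k else 0).
  by case: b => //; rewrite exprn_ge0 // ltW.
case: ifP => [PF|_]; last by rewrite sumr_ge0.
have [FB FZ] := h _ FFF PF.
rewrite (bigD1 (F :&: B)) //= properE subsetIl subsetI subxx FB.
by rewrite cardsD lerDl sumr_ge0.
Qed.

Lemma card_powerset_le B (Z : {set {set T * T}}) : (#|B| <= 4)%N ->
  Z \subset powerset B -> #|Z|%:R <= 16 :> R.
Proof.
move=> B4 /subset_leq_card; rewrite card_powerset => h.
rewrite (ler_nat _ _ 16); apply: leq_trans h _.
exact: (@leq_pexp2l 2 _ 4).
Qed.

(** All traces on [B] contain [p] and are nonempty, so [FF_sparse] applies to each of the at most
    [2 ^ 4] of them. *)
Lemma overlap_mass B (p : T * T) : (#|B| <= 4)%N -> p \in B ->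
  \sum_(F in FF | (p \in F) && ~~ (F \subset B)) iN ^+ #|F :\: B| <= 16 * eta.
Proof.
move=> B4 pB; pose Z := [set Q in powerset B | p \in Q].
apply: le_trans (@leq_ratio_mass B _ Z _) _.
  by move=> F _ /andP[pF FB]; split; rewrite // !inE subsetIr pF pB.
apply: (@le_trans _ _ (\sum_(Q in Z) eta)).
  apply: ler_sum => Q; rewrite inE => /andP[_ pQ]; apply: FF_sparse.
  by apply/set0Pn; exists p.
rewrite sumr_const -[leLHS]mulr_natl ler_wpM2r //.
by apply: (@card_powerset_le B) => //; apply/subsetP => Q; rewrite inE => /andP[].
Qed.

(** The trace may now be empty, where only [mass_all] is available; this costs a factor [N] against
    [overlap_mass], to be regained from the extra entry of [clash_pattern]. *)
Lemma residual_mass B : (#|B| <= 4)%N ->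
  \sum_(F in FF | ~~ (F \subset B)) iN ^+ #|F :\: B| <= 16 * (N%:R * eta).
Proof.
move=> B4; apply: le_trans (@leq_ratio_mass B _ (powerset B) _) _.
  by move=> F _ FB; split; rewrite // !inE subsetIr.
apply: (@le_trans _ _ (\sum_(Q in powerset B) N%:R * eta)).
  apply: ler_sum => Q _; have [->|Q0] := eqVneq Q finset.set0.
    apply: le_trans mass_all; rewrite big_mkcondr /=; apply: ler_sum => F _.
    by rewrite cards0 subn0; case: ifP.
  apply: le_trans (FF_sparse Q0) _; rewrite ler_peMl // ler1n.
  by rewrite /N; nlia.
rewrite sumr_const -[leLHS]mulr_natl ler_wpM2r ?mulr_ge0 //.
exact: (@card_powerset_le B).
Qed.

Lemma avoid_through_le2 S G : S \subset FF -> (#|G| <= 8)%N ->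
  (avoid_through S G)%:R <= 2 * pr #|G| * #|avoiders S|%:R.
Proof.
move=> SFF G8; apply: le_trans (avoid_through_le SFF G8) _.
rewrite ler_wpM2r // ler_wpM2r //; first by apply/ltW/pr_gt0; nlia.
by have := eta_small; rewrite /kappa; lra.
Qed.

Lemma avoid_through_ge_step S G F a c : let B := (a, c) |: G in
  S \subset FF -> F \in FF -> F \notin S -> (a, c) \notin G -> B \subset F ->
  (avoid_through S G)%:R <= (N - #|G|)%:R * (avoid_through S B)%:R
     + 80 * 64 * eta * pr #|G| * #|avoiders S|%:R.
Proof.
move=> B SFF FFF FS acG BF.
have acB : (a, c) \in B by rewrite !inE eqxx.
have cB : compat B B.
  apply/compatP => x y x' y' /(subsetP BF) h /(subsetP BF) h'.
  exact: (compatP _ _ (FF_inj FFF)).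
have B4 : (#|B| <= 4)%N.
  by apply: leq_trans (subset_leq_card BF) _; case/andP: (FF_size FFF).
have G3 : (#|G| <= 3)%N by move: B4; rewrite cardsU1 acG.
(* No avoided pattern lies inside [B], since [B] is part of [F] and the patterns form an antichain.
   Hence every [F'] still lacks an entry. *)
have nsub F' : F' \in S -> ~~ (F' \subset B).
  move=> F'S; apply/negP => F'B; move: FS.
  by rewrite -(FF_antichain (subsetP SFF _ F'S) FFF (subset_trans F'B BF)) F'S.
have F'4 F' : F' \in S -> (#|F' :\: B| <= 4)%N.
  move=> F'S; apply: leq_trans (subset_leq_card (subsetDl _ _)) _.
  by case/andP: (FF_size (subsetP SFF _ F'S)).
have := @avoid_through_switch_back T S G a c acG cB.
move=> /(_ (fun F' F'S => FF_inj (subsetP SFF _ F'S))).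
rewrite -/B -(ler_nat R) !natrD natrM => h; apply: le_trans h _.
rewrite -addrA lerD2l; set V : R := #|avoiders S|%:R.
have V0 : 0 <= V by [].
have prG : 0 < pr #|G| by apply: pr_gt0; nlia.
(* The share [8 * 64] is [2 * 16] from the upper bound times the 16 of [overlap_mass]. The second
   sum needs [64 * 64]: at most 4 entries [(x, y)], then [2 * 2 * 16] from the upper bound, then the
   16 of [residual_mass]. *)
have -> : 80 * 64 * eta * pr #|G| * V = 8 * 64 * eta * (pr #|G| * V) + 72 * 64 * eta * (pr #|G| * V) by ring.
apply: lerD.
  rewrite natr_sum.
  apply: (@le_trans _ _ (\sum_(F' in FF | ((a, c) \in F') && ~~ (F' \subset B))
      32 * (pr #|G| * V) * iN ^+ #|F' :\: B|)); last first.
    rewrite -mulr_sumr; have := overlap_mass B4 acB.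
    have : 0 <= pr #|G| * V by rewrite mulr_ge0 // ltW.
    set u := pr #|G| * V; set v := \sum_(_ in _ | _) _ => u0 hv; nra.
  rewrite [leRHS](bigID (mem S)) /= -[leLHS]addr0 lerD //; last first.
    rewrite sumr_ge0 // => F' _; rewrite !mulr_ge0 ?exprn_ge0 //; exact: ltW.
  rewrite le_eqVlt -le_eqVlt; rewrite [leRHS](eq_bigl (fun F' => (F' \in S) && ((a, c) \in F'))); last first.
    move=> F'; case F'S : (F' \in S); rewrite ?andbF //=.
    by rewrite (subsetP SFF) // (nsub _ F'S) !andbT.
  apply: ler_sum => F' /andP[F'S _].
  have cU : #|G :|: F' :\: B| = (#|G| + #|F' :\: B|)%N.
    rewrite cardsU disjoint_setI0 ?cards0 ?subn0 //.
    rewrite disjoint_sym disjoint_subset; apply/subsetP => q; rewrite !inE negb_or.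
    by case/andP => /andP[].
  have := F'4 _ F'S => F'4S.
  apply: le_trans (avoid_through_le2 SFF _) _; first by rewrite cU; nlia.
  rewrite cU -/V.
  have p1 : pr (#|G| + #|F' :\: B|) <= pr #|G| * (16 * iN ^+ #|F' :\: B|).
    apply: le_trans (pr_add _) _; first nlia.
    by rewrite ler_pM2l // expr2iN.
  move: p1; set u := pr (_ + _); set v := pr #|G|; set z := iN ^+ _ => p1.
  have -> : 32 * (v * V) * z = 2 * (v * (16 * z)) * V by ring.
  by rewrite ler_wpM2r // ler_pM2l.
rewrite natr_sum.
apply: (@le_trans _ _ (\sum_(F' in FF | ~~ (F' \subset B))
    16 * 16 * iN * (pr #|G| * V) * iN ^+ #|F' :\: B|)); last first.
  rewrite -mulr_sumr; have := residual_mass B4.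
  have : 0 <= pr #|G| * V by rewrite mulr_ge0 // ltW.
  set u := pr #|G| * V; set v := \sum_(_ in _ | _) _ => u0 hv.
  apply: (@le_trans _ _ (16 * 16 * iN * u * (16 * (N%:R * eta)))).
    by rewrite ler_wpM2l // !mulr_ge0 // ltW.
  have -> : 16 * 16 * iN * u * (16 * (N%:R * eta)) = 64 * 64 * (N%:R * iN) * eta * u by ring.
  by rewrite NiN mulr1 ler_wpM2r // ler_wpM2r //; lra.
rewrite [leRHS](bigID (mem S)) /= -[leLHS]addr0 lerD //; last first.
  rewrite sumr_ge0 // => F' _; rewrite !mulr_ge0 ?exprn_ge0 //; exact: ltW.
rewrite [leRHS](eq_bigl (fun F' => F' \in S)); last first.
  move=> F'; case F'S : (F' \in S); rewrite ?andbF //=.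
  by rewrite (subsetP SFF) // (nsub _ F'S) !andbT.
apply: ler_sum => F' F'S; have F'4S := F'4 _ F'S; rewrite natr_sum.
have GF8 : (#|G| + #|F' :\: B|.+1 <= 8)%N by nlia.
have prGF : 0 <= pr (#|G| + #|F' :\: B|.+1) by apply/ltW/pr_gt0/(leq_trans GF8).
have p1 : pr (#|G| + #|F' :\: B|.+1) <= pr #|G| * (2 * iN * (16 * iN ^+ #|F' :\: B|)).
  apply: le_trans (pr_add _) _; first nlia.
  by rewrite ler_pM2l // exprS ler_pM2l ?mulr_gt0 // expr2iN.
apply: (@le_trans _ _ (\sum_(q in F' :\: B) 2 * pr (#|G| + #|F' :\: B|.+1) * V)).
  rewrite big_mkcondr /=; apply: ler_sum => -[x y] /= xyF; case: ifP => [/andP[xa yc]|_]; last first.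
    by rewrite !mulr_ge0.
  have cp := @card_clash_pattern T G F' a c x y cB (FF_inj (subsetP SFF _ F'S)) xyF xa yc.
  apply: le_trans (avoid_through_le2 SFF _) _; first by rewrite cp.
  by rewrite cp.
rewrite sumr_const -[leLHS]mulr_natl.
apply: (@le_trans _ _ (4 * (2 * (pr #|G| * (2 * iN * (16 * iN ^+ #|F' :\: B|))) * V))).
  apply: ler_pM => //; [|by rewrite (ler_nat _ _ 4)|by rewrite ler_wpM2r // ler_pM2l].
  by rewrite !mulr_ge0.
by rewrite le_eqVlt; apply/orP; left; apply/eqP; ring.
Qed.

(** [F] is built up entry by entry. Because [(N - k) * pr (k + 1) = pr k], the errors of the steps
    add up in units of the target probability, and there are at most 4 steps. *)
Lemma avoid_through_ge S F : S \subset FF -> F \in FF -> F \notin S ->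
  (1 - 4 * 80 * 64 * eta) * pr #|F| * #|avoiders S|%:R <= (avoid_through S F)%:R.
Proof.
move=> SFF FFF FS; have [_ F4] := andP (FF_size FFF).
suff h k B : #|B| = k -> B \subset F ->
    (1 - 80 * 64 * k%:R * eta) * pr #|B| * #|avoiders S|%:R <= (avoid_through S B)%:R.
  apply: le_trans (h #|F| F erefl (subxx _)); rewrite ler_wpM2r // ler_wpM2r //.
    by apply/ltW/pr_gt0; nlia.
  rewrite lerD2l lerN2 ler_wpM2r //.
  have : #|F|%:R <= 4 :> R by rewrite (ler_nat _ _ 4).
  lra.
elim: k B => [|k IH] B Bk BF.
  by rewrite (cards0_eq Bk) avoid_through0 cards0 /pr ffactn0 invr1 mulr0 mul0r subr0 !mul1r.
have /card_gt0P[[a c] acB] : (0 < #|B|)%N by rewrite Bk.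
have BE := setD1K acB; have acG : (a, c) \notin B :\ (a, c) by rewrite !inE eqxx.
have cG : #|B :\ (a, c)| = k by move: Bk; rewrite (cardsD1 (a, c) B) acB => -[].
have B4 : (k < 4)%N by rewrite -Bk; apply: leq_trans (subset_leq_card BF) F4.
have := @avoid_through_ge_step S (B :\ (a, c)) F a c SFF FFF FS acG.
rewrite BE => /(_ BF); have := IH _ cG (subset_trans (subD1set _ _) BF).
rewrite cG Bk (prS (k := k)); last by nlia.
have Nk : 0 < (N - k)%:R :> R by rewrite ltr0n /N; nlia.
move=> h1 h2; rewrite -(ler_pM2l Nk).
set u := (avoid_through S _)%:R in h1 h2 *; set v := (avoid_through S B)%:R in h1 h2 *.
have := le_trans h1 h2; rewrite -lerBlDr; apply: le_trans.
by rewrite le_eqVlt; apply/orP; left; apply/eqP; rewrite -[k.+1]addn1 natrD; ring.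
Qed.

Lemma card_avoiders_add S F :
  #|avoiders S| = (#|avoiders (F |: S)| + avoid_through S F)%N.
Proof.
rewrite addnC -(cardsID [set s | contains s F]); congr (_ + _)%N; apply: eq_card => s.
  by rewrite !inE.
rewrite in_setD inE; apply/andP/avoidersP => [[sF /avoidersP sS] F'|h].
  by rewrite !inE => /orP[/eqP ->|/sS].
split; first by apply: h; rewrite !inE eqxx.
by apply/avoidersP => F' F'S; apply: h; rewrite !inE F'S orbT.
Qed.

(** Forbidding one more pattern multiplies the number of avoiders by [1 - q], where [q] is the
    conditional probability bounded on both sides above. Comparing each factor with an exponential
    turns the product into the sum of the [pr]. *)
Lemma avoiders_bounds : 
  ((#|T|)`!)%:R * expR (- ((1 + 4 * 80 * 64 * eta) * \sum_(F in FF) pr #|F|)) <= #|avoiders FF|%:R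
  <= ((#|T|)`!)%:R * expR (- ((1 - 4 * 80 * 64 * eta) * \sum_(F in FF) pr #|F|)).
Proof.
suff h k S : #|S| = k -> S \subset FF ->
    ((#|T|)`!)%:R * expR (- ((1 + 4 * 80 * 64 * eta) * \sum_(F in S) pr #|F|)) <= #|avoiders S|%:R
    <= ((#|T|)`!)%:R * expR (- ((1 - 4 * 80 * 64 * eta) * \sum_(F in S) pr #|F|)).
  exact: (h #|FF|).
elim: k S => [|k IH] S Sk SFF.
  by rewrite (cards0_eq Sk) !big_set0 !mulr0 oppr0 expR0 mulr1 avoiders_set0 lexx.
have /card_gt0P[F FS] : (0 < #|S|)%N by rewrite Sk.
have FFF := subsetP SFF _ FS; have [F2 F4] := andP (FF_size FFF).
have FS' : F \notin S :\ F by rewrite !inE eqxx.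
have S'FF : S :\ F \subset FF := subset_trans (subD1set _ _) SFF.
have S'k : #|S :\ F| = k by move: Sk; rewrite (cardsD1 F S) FS => -[].
have /andP[IH1 IH2] := IH _ S'k S'FF.
have ge := avoid_through_ge S'FF FFF FS'.
have le : (avoid_through (S :\ F) F)%:R <= (1 + 4 * kappa) * pr #|F| * #|avoiders (S :\ F)|%:R.
  by apply: avoid_through_le => //; nlia.
have E : #|avoiders (S :\ F)|%:R = #|avoiders S|%:R + (avoid_through (S :\ F) F)%:R :> R.
  by rewrite -natrD (card_avoiders_add _ F) setD1K.
have prF : 0 < pr #|F| by apply: pr_gt0; nlia.
(* The mass through any entry of [F] is at most [eta / N] and includes that of [F] itself; the
   factor 16 lost is at most [N]. *)
have prFe : pr #|F| <= eta.
  apply: le_trans (pr_le _) _; first by nlia.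
  apply: le_trans (expr2iN _) _ => //.
  have /card_gt0P[q qF] : (0 < #|F|)%N by nlia.
  apply: (@le_trans _ _ (16 * (iN * eta))); last first.
    rewrite mulrA ler_piMl //; have := iN16; lra.
  rewrite ler_pM2l //; apply: le_trans (mass_through q).
  rewrite (bigD1 F) /=; last by rewrite FFF qF.
  by rewrite lerDl sumr_ge0.
have SE (x : R) : x * (\sum_(F' in S) pr #|F'|) = x * pr #|F| + x * \sum_(F' in S :\ F) pr #|F'|.
  by rewrite (big_setD1 F) //= mulrDr.
rewrite !SE !opprD !expRD; set y := expR (- (_ * \sum_(_ in _) _)) in IH1 *.
set z := expR (- (_ * \sum_(_ in _) _)) in IH2 *.
set W : R := ((#|T|)`!)%:R in IH1 IH2 *; set V := #|avoiders (S :\ F)|%:R in IH1 IH2 ge le E.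
have V0 : 0 <= V by [].
apply/andP; split.
  have -> : #|avoiders S|%:R = V - (avoid_through (S :\ F) F)%:R by rewrite E addrK.
  set q := (1 + 4 * kappa) * pr #|F| in le.
  have e1 := eta_small.
  have q0 : 0 < q by rewrite mulr_gt0 // /kappa; lra.
  have q2 : q <= 2 * pr #|F| by rewrite /q ler_pM2r // /kappa; lra.
  have q3 : q <= 2^-1 by lra.
  (* With [x] the negated exponent, [q <= x * (1 - q)] gives that the inverse of [1 - q] is at most
     [1 + x], hence at most [expR x]. *)
  have e2 : expR (- ((1 + 4 * 80 * 64 * eta) * pr #|F|)) <= 1 - q.
    have h : (1 - q)^-1 <= expR ((1 + 4 * 80 * 64 * eta) * pr #|F|).
      apply: le_trans (expR_ge1Dx _); rewrite -[leLHS]mul1r ler_pdivrMr; last by lra.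
      suff : q <= (1 + 4 * 80 * 64 * eta) * pr #|F| * (1 - q).
        by move=> h; rewrite mulrDl mul1r; lra.
      apply: (@le_trans _ _ ((1 + 64 * 16 * eta) * pr #|F|)).
        by rewrite le_eqVlt; apply/orP; left; apply/eqP; rewrite /q /kappa; ring.
      rewrite [leRHS]mulrAC ler_pM2r //.
      have e3 : q <= 2 * eta by move: q2 prFe; lra.
      exact: rate_slack.
    rewrite expRN -[leRHS]invrK lef_pV2 // ?posrE ?expR_gt0 // invr_gt0; lra.
  apply: (@le_trans _ _ ((1 - q) * V)); last by rewrite mulrBl mul1r lerD2l lerN2.
  rewrite mulrCA; by apply: ler_pM => //; rewrite ?mulr_ge0 ?expR_ge0.
have -> : #|avoiders S|%:R = V - (avoid_through (S :\ F) F)%:R by rewrite E addrK.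
set q := (1 - 4 * 80 * 64 * eta) * pr #|F| in ge *.
apply: (@le_trans _ _ ((1 - q) * V)); first by rewrite mulrBl mul1r lerD2l lerN2.
apply: (@le_trans _ _ (expR (- q) * V)); first by rewrite ler_wpM2r // expR_ge1Dx.
by rewrite mulrCA ler_pM2l ?expR_gt0.
Qed.

Lemma sum_pr_le : \sum_(F in FF) pr #|F| <= 16 * (N%:R * eta).
Proof.
apply: le_trans (ler_wpM2l _ mass_all); last by [].
rewrite mulr_sumr; apply: ler_sum => F FFF.
by apply: le_trans (pr_le _) (expr2iN _); case/andP: (FF_size FFF); nlia.
Qed.

End LocalLemma.

(** * Permutations with a prescribed bipartite graph *)

Section FibredPermutations.
Variables (T Y : finType).
Implicit Types (lam mu : T -> Y).

Let fib mu (y : Y) := [set a | mu a == y].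

Lemma exists_relabelling lam mu : (forall y, #|fib mu y| = #|fib lam y|) ->
  exists s : {perm T}, forall a, lam (s a) = mu a.
Proof.
move=> h.
(* The i-th point of each fibre of [mu] goes to the i-th point of the corresponding fibre of
   [lam]. *)
pose f a := nth a (enum (fib lam (mu a))) (index a (enum (fib mu (mu a)))).
have idx a : (index a (enum (fib mu (mu a))) < size (enum (fib lam (mu a))))%N.
  by rewrite -cardE -h cardE index_mem mem_enum inE.
have fP a : lam (f a) = mu a.
  by have := mem_nth a (idx a); rewrite mem_enum inE => /eqP.
have f_inj : injective f.
  move=> a b fab; have mab : mu a = mu b by rewrite -!fP fab.
  move/eqP: fab; rewrite /f (set_nth_default a b) // mab.
  rewrite nth_uniq ?enum_uniq -?mab ?idx //; last by rewrite mab idx.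
  move/eqP => E; rewrite -(nth_index a (s := enum (fib mu (mu a))) (x := a)) ?mem_enum ?inE //.
  by rewrite E nth_index // mab mem_enum inE.
by exists (perm f_inj) => a; rewrite permE fP.
Qed.

(** The stabiliser is the product of the symmetric groups of the fibres; [FM] is that product, and
    [g] glues its components. *)
Lemma card_fibre_stabiliser lam :
  #|[set s : {perm T} | [forall a, lam (s a) == lam a]]| = (\prod_y (#|fib lam y|)`!)%N.
Proof.
pose FM := [set z : {ffun Y -> {perm T}} | [forall y, perm_on (fib lam y) (z y)]].
have -> : (\prod_y (#|fib lam y|)`! = #|FM|)%N.
  under eq_bigr do rewrite -card_perm.
  transitivity #|family (fun y => [pred s | perm_on (fib lam y) s])|.
    by rewrite card_family foldrE big_image; apply: eq_bigr.
  by apply: eq_card => z; rewrite [RHS]inE; apply/familyP/forallP.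
have zlam (z : {ffun Y -> {perm T}}) a : z \in FM -> lam (z (lam a) a) = lam a.
  rewrite inE => /forallP /(_ (lam a)) on.
  by have := perm_closed a on; rewrite !inE eqxx => /eqP.
pose g (z : {ffun Y -> {perm T}}) a := z (lam a) a.
have g_inj z : z \in FM -> injective (g z).
  move=> zF a b gab; have lab : lam a = lam b by rewrite -(zlam z a zF) -(zlam z b zF) -/(g z a) gab.
  by move: gab; rewrite /g lab => /perm_inj.
(* For [z] in [FM] the glued map is injective, so the default value 1 never occurs there. *)
pose G z := odflt 1%g (insub (finfun (g z)) : option {perm T}).
have GE z a : z \in FM -> G z a = g z a.
  move=> zF; rewrite /G insubT /=.
    by apply/injectiveP => x y; rewrite !ffunE; apply: g_inj.
  by move=> p; rewrite -pvalE /= ffunE.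
have inj : {in FM &, injective G}.
  move=> z z' zF z'F Gzz; apply/ffunP => y; apply/permP => a.
  have [<-|nay] := eqVneq (lam a) y; first by rewrite -/(g z a) -/(g z' a) -!GE // Gzz.
  move: zF z'F; rewrite !inE => /forallP /(_ y) on /forallP /(_ y) on'.
  by rewrite (out_perm on) ?(out_perm on') // inE.
rewrite -(card_in_imset inj); apply: eq_card => s; rewrite inE.
apply/forallP/imsetP => [h|[z zF ->] a]; last by rewrite GE // /g zlam.
pose f y a := if lam a == y then s a else a.
have f_inj y : injective (f y).
  move=> a b; rewrite /f; case: eqP => [ay|ay]; case: eqP => [by_|by_] //.
  - exact: perm_inj.
  - by move=> E; case: by_; rewrite -E (eqP (h a)).
  - by move=> E; case: ay; rewrite E (eqP (h b)).
pose z := [ffun y => perm (f_inj y)].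
have zF : z \in FM.
  rewrite inE; apply/forallP => y; apply/subsetP => a; rewrite !inE ffunE permE /f.
  by case: ifP => // _; rewrite eqxx.
by exists z => //; apply/permP => a; rewrite GE // /g ffunE permE /f eqxx.
Qed.

(** The solutions form a coset of the stabiliser. *)
Lemma card_relabellings lam mu : (forall y, #|fib mu y| = #|fib lam y|) ->
  #|[set s : {perm T} | [forall a, lam (s a) == mu a]]| = (\prod_y (#|fib lam y|)`!)%N.
Proof.
move=> /exists_relabelling[s0 h].
rewrite -card_fibre_stabiliser -[RHS](card_imset _ (mulgI s0)).
apply: eq_card => s; rewrite [LHS]inE; apply/forallP/imsetP => [hs|[p + ->] a]; last first.
  by rewrite inE permM => /forallP /(_ (s0 a)) /eqP ->; rewrite h.
exists (s0^-1 * s)%g; last by rewrite mulKVg.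
by rewrite inE; apply/forallP => a; rewrite permM (eqP (hs _)) -h permKV.
Qed.

End FibredPermutations.

Section PrescribedBigraph.
Variables (T X Y : finType) (rho : T -> X) (lam : T -> Y).

Definition bigraph (s : {perm T}) : {set X * Y} := [set (rho a, lam (s a)) | a : T].

(** Since [#|B| = #|T|], the edges of [B] can be listed as an injection [e] on [T]. A permutation
    [s] with simple bigraph [B] determines a second permutation [p], telling which edge each point
    becomes. Counting the pairs with [p] first decouples the two sides: [p] only has to match the
    row labels, and for fixed [p] the permutation [s] only has to match the column labels. *)
Lemma card_perm_bigraph (B : {set X * Y}) :
  (forall x, #|[set y | (x, y) \in B]| = #|[set a | rho a == x]|) ->
  (forall y, #|[set x | (x, y) \in B]| = #|[set a | lam a == y]|) ->
  #|[set s : {perm T} | [forall a, forall b, (rho a == rho b) && (lam (s a) == lam (s b)) ==> (a == b)]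
       && (bigraph s == B)]|
  = ((\prod_x (#|[set a | rho a == x]|)`!) * (\prod_y (#|[set a | lam a == y]|)`!))%N.
Proof.
move=> hX hY.
have pairl x : injective (fun y : Y => (x, y)) by move=> ? ? [].
have pairr y : injective (fun x : X => (x, y)) by move=> ? ? [].
have cB : #|B| = #|T|.
  rewrite -!sum1_card (partition_big (fun z => z.1) predT) //=.
  rewrite [RHS](partition_big rho predT) //=; apply: eq_bigr => x _.
  have -> : \sum_(z in B | z.1 == x) 1 = #|[set y | (x, y) \in B]|.
    rewrite -[RHS](card_imset _ (@pairl _ x)).
    rewrite -sum1_card; apply: eq_bigl => -[x' y] /=; apply/andP/imsetP => [[zB /eqP <-]|[y' + [-> ->]]].
      by exists y; rewrite ?inE.
    by rewrite inE => ->.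
  by rewrite hX -sum1_card; apply: eq_bigl => a; rewrite inE.
have eE : exists2 e : T -> X * Y, injective e & forall z, (z \in B) = [exists a, e a == z].
  (* With [T] empty there may be no default edge for [nth]. *)
  have [T0|/card_gt0P[t0 _]] := posnP #|T|.
    have noT (a : T) : False by have := card0_eq T0 a; rewrite inE.
    exists (fun a => False_rect _ (noT a)) => [a|z]; first by case: (noT a).
    move/cards0_eq: (etrans cB T0) => ->; rewrite inE; apply/esym/existsP => -[a].
    by case: (noT a).
  have /card_gt0P[z0 z0B] : (0 < #|B|)%N by rewrite cB; apply/card_gt0P; exists t0.
  have sz (a : T) : (enum_rank a < size (enum B))%N by rewrite -cardE cB.
  exists (fun a => nth z0 (enum B) (enum_rank a)) => [a b|z].
    by move/eqP; rewrite nth_uniq ?enum_uniq // => /eqP /val_inj /enum_rank_inj.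
  apply/idP/existsP => [zB|[a /eqP <-]]; last by rewrite -mem_enum mem_nth.
  have zi : (index z (enum B) < #|T|)%N by rewrite -cB cardE index_mem mem_enum.
  by exists (enum_val (Ordinal zi)); rewrite enum_valK /= nth_index ?mem_enum.
case: eE => e e_inj eB.
pose P := [set z : {perm T} * {perm T} | [forall a, e (z.1 a) == (rho a, lam (z.2 a))]].
set G := [set s | _].
have PE z : z \in P -> forall a, e (z.1 a) = (rho a, lam (z.2 a)).
  by rewrite inE => /forallP h a; apply/eqP.
have -> : #|G| = #|P|.
  have inj : {in P &, injective (fun z : {perm T} * {perm T} => z.2)}.
    move=> [p s] [p' s'] /PE h /PE h' /= ss; rewrite -{}ss in h' *; congr pair.
    by apply/permP => a; apply: e_inj; rewrite h h'.
  rewrite -(card_in_imset inj); apply: eq_card => s; rewrite inE.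
  apply/andP/imsetP => [[/'forall_forallP s_inj /eqP sB]|[[p s'] /PE /= h -> /=]]; last first.
    split.
      apply/'forall_forallP => a b; apply/implyP => /andP[/eqP rr /eqP ll].
      by apply/eqP/(@perm_inj _ p)/e_inj; rewrite !h rr ll.
    apply/eqP/setP => z; rewrite eB; apply/imsetP/existsP => [[a _ ->]|[a /eqP <-]].
      by exists (p a); rewrite h.
    by exists ((p^-1)%g a); rewrite // -h permKV.
  have ex a : {b | e b == (rho a, lam (s a))}.
    by apply/sigW/existsP; rewrite -eB -sB; apply: imset_f.
  pose f a := sval (ex a).
  have fE a : e (f a) = (rho a, lam (s a)) by apply/eqP; rewrite /f; case: (ex a).
  have f_inj : injective f.
    move=> a b fab; have := fE a; rewrite fab fE => -[rr ll].
    by have /implyP := s_inj a b; rewrite rr ll !eqxx => /(_ isT) /eqP.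
  exists (perm f_inj, s) => //; rewrite inE; apply/forallP => a /=.
  by rewrite permE fE.
have rowE x : #|[set a | (e a).1 == x]| = #|[set a | rho a == x]|.
  rewrite -hX -(card_imset _ e_inj).
  rewrite -[RHS](card_imset _ (@pairl _ x)).
  apply: eq_card => -[x' y]; apply/imsetP/imsetP => [[a + E]|[y' + [-> ->]]].
    rewrite inE => /eqP h; exists y; last by rewrite -h -E.
    by rewrite inE -h -[y]/((x', y).2) E -surjective_pairing eB; apply/existsP; exists a.
  by rewrite inE eB => /existsP[a /eqP E]; exists a; rewrite ?inE ?E.
have colE y : #|[set a | (e a).2 == y]| = #|[set a | lam a == y]|.
  rewrite -hY -(card_imset _ e_inj).
  rewrite -[RHS](card_imset _ (@pairr _ y)).
  apply: eq_card => -[x y']; apply/imsetP/imsetP => [[a + E]|[x' + [-> ->]]].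
    rewrite inE => /eqP h; exists x; last by rewrite -h -E.
    by rewrite inE -h -[x]/((x, y').1) E -surjective_pairing eB; apply/existsP; exists a.
  by rewrite inE eB => /existsP[a /eqP E]; exists a; rewrite ?inE ?E.
pose Q := [set p : {perm T} | [forall a, (e (p a)).1 == rho a]].
have cQ : #|Q| = (\prod_x (#|[set a | rho a == x]|)`!)%N.
  rewrite (@card_relabellings _ _ (fun a => (e a).1) rho) => [|x]; last by rewrite rowE.
  by apply: eq_bigr => x _; rewrite rowE.
rewrite -cQ -[LHS]sum1_card -sum_nat_const.
rewrite (eq_bigl (fun z : {perm T} * {perm T} => (z.1 \in Q) && [forall a, lam (z.2 a) == (e (z.1 a)).2])); last first.
  move=> [p s] /=; rewrite inE /= inE; apply/forallP/andP => [h|[/forallP h /forallP h'] a].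
    by split; apply/forallP => a; rewrite (eqP (h a)).
  by rewrite [e _]surjective_pairing (eqP (h a)) (eqP (h' a)).
rewrite -(pair_big_dep (fun p => p \in Q) (fun p (s : {perm T}) => [forall a, lam (s a) == (e (p a)).2]) (fun _ _ => 1%N)) /=.
apply: eq_bigr => p _; rewrite -(@card_relabellings _ _ lam (fun a => (e (p a)).2)) => [|y].
  by rewrite -sum1_card; apply: eq_bigl => s; rewrite inE.
rewrite -colE -(card_imset _ (@perm_inj _ p)); apply: eq_card => a.
apply/imsetP/idP => [[b + ->]|]; rewrite inE => h; first by rewrite inE.
by exists ((p^-1)%g a); rewrite ?inE permKV.
Qed.

End PrescribedBigraph.

(** * Forbidden patterns *)

Lemma uniq_map_inj_in (U V : eqType) (f : U -> V) (s : seq U) :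
  uniq (map f s) -> {in s &, injective f}.
Proof.
elim: s => //= a s IH /andP[fas us] x y; rewrite !inE.
case/predU1P => [->|xs] /predU1P[->|ys] // E; last exact: IH.
  by case/negP: fas; rewrite E map_f.
by case/negP: fas; rewrite -E map_f.
Qed.

Lemma compat_seq (T : finType) (s : seq (T * T)) :
  uniq (map fst s) -> uniq (map snd s) -> compat [set p in s] [set p in s].
Proof.
move=> u1 u2; apply/forall_inP => p; rewrite inE => ps; apply/forall_inP => q; rewrite inE => qs.
apply/eqP; apply/eqP/eqP => E.
  by rewrite (uniq_map_inj_in u1 ps qs E).
by rewrite (uniq_map_inj_in u2 ps qs E).
Qed.

Section ForbiddenPatterns.
Variables (T X Y : finType) (rho : T -> X) (lam : T -> Y) (slot : pred Y).
Implicit Types (p q : T * T) (s : {perm T}).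

(* [rho] sends a row to its vertex in [R]; [lam] sends a column to its vertex in [L], or to its slot.
   A permutation containing a [par] gives a double edge towards [L], or a loop if the common label
   is a slot. *)
Definition par p q :=
  [&& rho p.1 == rho q.1, lam p.2 == lam q.2, p.1 != q.1 & p.2 != q.2].

(* [p1], [p2] fill one slot and [p3], [p4] another, both with the same pair of distinct vertices:
   a double edge inside [R]. *)
Definition quad p1 p2 p3 p4 :=
  [&& rho p1.1 == rho p3.1, rho p2.1 == rho p4.1, rho p1.1 != rho p2.1, p1.1 != p3.1, p2.1 != p4.1,
      lam p1.2 == lam p2.2, lam p3.2 == lam p4.2, p1.2 != p2.2, p3.2 != p4.2,
      lam p1.2 != lam p3.2, slot (lam p1.2) & slot (lam p3.2)].

Definition double_edges : {set {set T * T}} :=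
  [set [set p in [:: z.1; z.2]] | z in [set z : (T * T) * (T * T) | par z.1 z.2]].

Definition twin_slots : {set {set T * T}} :=
  [set [set p in [:: z.1.1; z.1.2; z.2.1; z.2.2]] |
     z in [set z : ((T * T) * (T * T)) * ((T * T) * (T * T)) | quad z.1.1 z.1.2 z.2.1 z.2.2]].

Lemma double_edgesP F :
  reflect (exists p q, par p q /\ F = [set x in [:: p; q]]) (F \in double_edges).
Proof.
apply: (iffP imsetP) => [[[p q]]|[p [q [pq ->]]]]; first by rewrite inE /= => pq ->; exists p, q.
by exists (p, q); rewrite ?inE.
Qed.

Lemma twin_slotsP F : reflect
  (exists p1 p2 p3 p4, quad p1 p2 p3 p4 /\ F = [set x in [:: p1; p2; p3; p4]]) (F \in twin_slots).
Proof.
apply: (iffP imsetP) => [[[[p1 p2] [p3 p4]]]|[p1 [p2 [p3 [p4 [pq ->]]]]]].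
  by rewrite inE /= => pq ->; exists p1, p2, p3, p4.
by exists ((p1, p2), (p3, p4)); rewrite ?inE.
Qed.

Lemma par_irrefl p : par p p = false.
Proof. by rewrite /par !eqxx. Qed.

Lemma par_sym p q : par p q = par q p.
Proof.
by rewrite /par (eq_sym (rho _)) (eq_sym (lam _)) (eq_sym p.1) (eq_sym p.2).
Qed.

Lemma par_uniq p q : par p q -> uniq (map fst [:: p; q]) && uniq (map snd [:: p; q]).
Proof. by case/and4P => _ _ n1 n2; rewrite /= !inE n1 n2. Qed.

Lemma quad_uniq p1 p2 p3 p4 : quad p1 p2 p3 p4 ->
  uniq (map fst [:: p1; p2; p3; p4]) && uniq (map snd [:: p1; p2; p3; p4]).
Proof.
case/and5P => /eqP r13 /eqP r24 r12 n13 /and5P[n24 /eqP l12 /eqP l34 m12 /and4P[m34 l13 _ _]].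
have neq (U V : eqType) (f : U -> V) x y : f x != f y -> x != y.
  by apply: contra => /eqP ->.
rewrite /= !inE !negb_or n13 n24 m12 m34 !andbT /=.
have -> : p1.1 != p2.1 by apply: neq r12.
have -> : p1.1 != p4.1 by apply: (neq _ _ rho); rewrite -r24.
have -> : p2.1 != p3.1 by apply: (neq _ _ rho); rewrite -r13 eq_sym.
have -> : p3.1 != p4.1 by apply: (neq _ _ rho); rewrite -r13 -r24.
have -> : p1.2 != p3.2 by apply: neq l13.
have -> : p1.2 != p4.2 by apply: (neq _ _ lam); rewrite -l34.
have -> : p2.2 != p3.2 by apply: (neq _ _ lam); rewrite -l12.
by have -> : p2.2 != p4.2 by apply: (neq _ _ lam); rewrite -l12 -l34.
Qed.

Lemma card_uniq_seq (U : finType) (l : seq U) : uniq l -> #|[set x in l]| = size l.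
Proof. by move=> /card_uniqP <-; apply: eq_card => x; rewrite inE. Qed.

Lemma card_double_edge F : F \in double_edges -> #|F| = 2%N.
Proof.
case/double_edgesP => p [q [/par_uniq/andP[u _] ->]].
by rewrite card_uniq_seq // (map_uniq u).
Qed.

Lemma card_twin_slots F : F \in twin_slots -> #|F| = 4%N.
Proof.
case/twin_slotsP => p1 [p2 [p3 [p4 [/quad_uniq/andP[u _] ->]]]].
by rewrite card_uniq_seq // (map_uniq u).
Qed.

Definition forbidden := double_edges :|: twin_slots.

Lemma card_forbidden F : F \in forbidden -> (2 <= #|F| <= 4)%N.
Proof. by rewrite inE => /orP[/card_double_edge ->|/card_twin_slots ->]. Qed.

Lemma compat_forbidden F : F \in forbidden -> compat F F.
Proof.
rewrite inE => /orP[/double_edgesP[p [q [/par_uniq/andP[u1 u2] ->]]]|].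
  exact: compat_seq.
case/twin_slotsP => p1 [p2 [p3 [p4 [/quad_uniq/andP[u1 u2] ->]]]].
exact: compat_seq.
Qed.

(** Equal vertices occur only in the pairs 1, 3 and 2, 4, and equal slots only in 1, 2 and 3, 4, so
    no two distinct entries agree in both. This makes the mixed family of patterns an antichain. *)
Lemma quad_no_par p1 p2 p3 p4 p q : quad p1 p2 p3 p4 ->
  p \in [:: p1; p2; p3; p4] -> q \in [:: p1; p2; p3; p4] -> ~~ par p q.
Proof.
case/and5P => /eqP r13 /eqP r24 /negPf r12 n13 /and5P[n24 /eqP l12 /eqP l34 m12 /and4P[m34 /negPf l13 _ _]].
have r21 := r12; have l31 := l13; rewrite eq_sym in r21; rewrite eq_sym in l31.
rewrite /par; case/or4P => [|||/predU1P[|//]] => [/eqP|/eqP|/eqP|] ->;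
  case/or4P => [|||/predU1P[|//]] => [/eqP|/eqP|/eqP|] ->;
  by rewrite ?eqxx -?r13 -?r24 -?l12 -?l34 ?r12 ?r21 ?l13 ?l31 ?andbF.
Qed.

Lemma forbidden_antichain F F' :
  F \in forbidden -> F' \in forbidden -> F \subset F' -> F = F'.
Proof.
move=> hF hF' sub; apply/eqP; rewrite eqEcard sub /=.
move: hF hF'; rewrite !inE => /orP[hF|/card_twin_slots ->]; last first.
  by case/orP => [/card_double_edge ->|/card_twin_slots ->] //.
case/orP => [hF'|hF']; first by rewrite !card_double_edge.
case/double_edgesP: hF sub => p [q [pq ->]] /subsetP sub.
case/twin_slotsP: hF' sub => p1 [p2 [p3 [p4 [qd ->]]]] sub.
have := sub p; rewrite !in_set mem_head => /(_ isT) hp.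
have := sub q; rewrite !in_set inE mem_head orbT => /(_ isT) hq.
by have := quad_no_par qd hp hq; rewrite pq.
Qed.

Definition nbr (B : {set X * Y}) (y : Y) := [set x | (x, y) \in B].

Hypothesis slot2 : forall k, slot k -> #|[set c | lam c == k]| = 2%N.

Lemma mem_nbr s x k : reflect (exists2 a, rho a = x & lam (s a) = k) (x \in nbr (bigraph rho lam s) k).
Proof.
rewrite inE; apply: (iffP imsetP) => [[a _ [-> ->]]|[a <- <-]]; first by exists a.
by exists a.
Qed.

Lemma card_nbr_slot s k : slot k -> (#|nbr (bigraph rho lam s) k| <= 2)%N.
Proof.
move=> sk; apply: (@leq_trans #|[set rho ((s^-1)%g c) | c in [set c | lam c == k]]|).
  apply/subset_leq_card/subsetP => x /mem_nbr[a <- ak]; apply/imsetP.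
  by exists (s a); rewrite ?inE ?ak // permK.
by rewrite -(slot2 sk) leq_imset_card.
Qed.

Lemma nbr_quad s p1 p2 k : slot k -> lam p1.2 = k -> lam p2.2 = k -> s p1.1 = p1.2 -> s p2.1 = p2.2 ->
  rho p1.1 != rho p2.1 -> nbr (bigraph rho lam s) k = [set rho p1.1; rho p2.1].
Proof.
move=> sk l1 l2 s1 s2 r12; apply/esym/eqP; rewrite eqEcard; apply/andP; split.
  apply/subsetP => x; rewrite in_set2 => /orP[]/eqP ->; apply/mem_nbr.
    by exists p1.1; rewrite // s1.
  by exists p2.1; rewrite // s2.
by rewrite cards2 r12 card_nbr_slot.
Qed.

(** The first condition excludes loops as well as double edges to [L]. Once it holds, each slot has
    two different ends, so two slots with the same neighbours really produce a [quad]. *)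
Lemma mem_avoiders_forbidden s : (s \in avoiders forbidden) =
  [forall a, forall b, (rho a == rho b) && (lam (s a) == lam (s b)) ==> (a == b)] &&
  [forall k, forall l, [&& slot k, slot l & k != l] ==>
     (nbr (bigraph rho lam s) k != nbr (bigraph rho lam s) l)].
Proof.
apply/avoidersP/andP => [av|[/'forall_forallP inj /'forall_forallP tw] F]; last first.
  rewrite inE => /orP[/double_edgesP[p [q [/and4P[rr ll n _] ->]]]|].
    apply/negP => /containsP c.
    have s1 : s p.1 = p.2 by apply: c; rewrite -surjective_pairing inE mem_head.
    have s2 : s q.1 = q.2 by apply: c; rewrite -surjective_pairing !inE eqxx orbT.
    by have := inj p.1 q.1; rewrite rr s1 s2 ll (negPf n).
  case/twin_slotsP => p1 [p2 [p3 [p4 [qd ->]]]]; apply/negP => /containsP c.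
  have [s1 s2 s3 s4] : [/\ s p1.1 = p1.2, s p2.1 = p2.2, s p3.1 = p3.2 & s p4.1 = p4.2].
    by split; apply: c; rewrite -surjective_pairing !inE eqxx ?orbT.
  case/and5P: qd => /eqP r13 /eqP r24 r12 n13 /and5P[n24 /eqP l12 /eqP l34 m12 /and4P[m34 l13 k1 k2]].
  have := tw (lam p1.2) (lam p3.2); rewrite k1 k2 l13 /=.
  rewrite (@nbr_quad s p1 p2) // (@nbr_quad s p3 p4) -?r13 -?r24 //.
  by rewrite eqxx.
have inj a b : rho a = rho b -> lam (s a) = lam (s b) -> a = b.
  move=> rr ll; apply/eqP/negPn/negP => nab.
  have hF : [set x in [:: (a, s a); (b, s b)]] \in forbidden.
    rewrite inE; apply/orP; left; apply/double_edgesP; exists (a, s a), (b, s b).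
    by rewrite /par /= rr ll !eqxx (inj_eq perm_inj) nab.
  move/negP: (av _ hF); apply; apply/containsP => x y; rewrite !inE !xpair_eqE.
  by case/orP => /andP[/eqP -> /eqP ->].
split; first by apply/'forall_forallP => a b; apply/implyP => /andP[/eqP rr /eqP ll]; apply/eqP/inj.
apply/'forall_forallP => k l; apply/implyP => /and3P[sk sl kl]; apply/negP => /eqP nkl.
have [c1 [c2 [c12 cE]]] := cards2P _ (introT eqP (slot2 sk)).
have k1 : lam c1 = k by apply/eqP; have := set21 c1 c2; rewrite -cE inE.
have k2 : lam c2 = k by apply/eqP; have := set22 c1 c2; rewrite -cE inE.
pose a := (s^-1)%g c1; pose a' := (s^-1)%g c2.
have sa : s a = c1 by rewrite permKV.
have sa' : s a' = c2 by rewrite permKV.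
have raa' : rho a != rho a'.
  apply/eqP => h; have := inj _ _ h; rewrite sa sa' k1 k2 => /(_ erefl) aa'.
  by move: c12; rewrite -sa -sa' aa' eqxx.
have /mem_nbr[b rb lb] : rho a \in nbr (bigraph rho lam s) l.
  by rewrite -nkl; apply/mem_nbr; exists a; rewrite // sa.
have /mem_nbr[b' rb' lb'] : rho a' \in nbr (bigraph rho lam s) l.
  by rewrite -nkl; apply/mem_nbr; exists a'; rewrite // sa'.
suff hF : [set x in [:: (a, s a); (a', s a'); (b, s b); (b', s b')]] \in forbidden.
  move/negP: (av _ hF); apply; apply/containsP => x y; rewrite !inE !xpair_eqE.
  by case/or4P => /andP[/eqP -> /eqP ->].
rewrite inE; apply/orP; right; apply/twin_slotsP.
exists (a, s a), (a', s a'), (b, s b), (b', s b'); split => //.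
have lneq x y : lam (s x) = k -> lam (s y) = l -> x != y.
  by move=> hx hy; apply: contra kl => /eqP E; rewrite -hx -hy E.
rewrite /quad /= rb rb' !eqxx raa' sa sa' k1 k2 lb lb' !eqxx sk sl kl c12 (lneq a b) ?sa // (lneq a' b') ?sa' //=.
by rewrite (inj_eq perm_inj) andbT; apply: contra raa' => /eqP E; rewrite -rb -rb' E.
Qed.

End ForbiddenPatterns.

(** * B-graphs as bipartite graphs *)

Section GraphsAndBigraphs.
Variables (n : nat) (L R : {set 'I_n}) (d : 'I_n -> nat) (h : nat).
Hypothesis bip : bipartition L R.
Hypothesis hE : (M1 d L + h.*2 = M1 d R)%N.
Implicit Types (E : {set {set 'I_n}}) (t : {ffun 'I_h -> {set 'I_n}})
  (B : {set 'I_n * ('I_n + 'I_h)}).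

Definition row_degree v := if v \in R then d v else 0.
Definition col_degree (y : 'I_n + 'I_h) :=
  match y with inl i => if i \in L then d i else 0 | inr _ => 2 end.

(* The two neighbours of a slot are the ends of an edge inside [R]. *)
Definition good_bigraphs : {set {set 'I_n * ('I_n + 'I_h)}} :=
  [set B : {set 'I_n * ('I_n + 'I_h)} | [&& [forall v, #|[set y | (v, y) \in B]| == row_degree v],
               [forall y, #|nbr B y| == col_degree y] &
               [forall k : 'I_h, forall l : 'I_h, (k != l) ==> (nbr B (inr k) != nbr B (inr l))]]].

Definition graphs : {set {set {set 'I_n}}} :=
  [set E | B_graph L R E && [forall i, degree E i == d i]].

Definition inner E := [set e in E | e \subset R].

(** [z.1] is a graph and [z.2] a numbering of its edges inside [R] by the slots. A cross edge
    becomes one cell, an inner edge the two cells in the column of its slot. *)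
Definition to_bigraph (z : {set {set 'I_n}} * {ffun 'I_h -> {set 'I_n}}) : {set 'I_n * ('I_n + 'I_h)} :=
  [set p | match p.2 with
           | inl i => [&& p.1 \in R, i \in L & [set p.1; i] \in z.1]
           | inr k => p.1 \in z.2 k
           end].

Let notLR v : v \in L -> v \in R = false.
Proof. by case/andP: bip => dis _ vL; apply: (disjointFr dis). Qed.

Let LR v : v \notin R -> v \in L.
Proof.
case/andP: bip => _ /eqP cov; have : v \in L :|: R by rewrite cov inE.
by rewrite inE => /orP[//|->].
Qed.

Lemma cross_inj v i v' i' : v \in R -> i \in L -> v' \in R -> i' \in L ->
  [set v; i] = [set v'; i'] -> v = v' /\ i = i'.
Proof.
move=> vR iL v'R i'L E; split.
  have : v \in [set v'; i'] by rewrite -E set21.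
  by rewrite !inE => /orP[/eqP //|/eqP vi]; move: vR; rewrite vi notLR.
have : i \in [set v'; i'] by rewrite -E set22.
by rewrite !inE => /orP[/eqP iv|/eqP //]; rewrite -iv notLR in v'R.
Qed.

Lemma edge_cases E e : simple_graph E -> independent E L -> e \in E ->
  e \subset R \/ exists v i, [/\ v \in R, i \in L & e = [set v; i]].
Proof.
move=> /forall_inP sg /forall_inP ind eE.
have [x [y [_ exy]]] := cards2P _ (sg _ eE).
have [xR|/LR xL] := boolP (x \in R); have [yR|/LR yL] := boolP (y \in R).
- by left; rewrite exy; apply/subsetP => z; rewrite !inE => /orP[]/eqP ->.
- by right; exists x, y.
- by right; exists y, x; rewrite setUC.
- by have /forall_inP /(_ _ yL) := ind _ xL; rewrite -exy eE.
Qed.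

(** Count degrees on both sides: a cross edge contributes 1 to [L] and to [R], an inner edge
    contributes 2 to [R] only, so the excess of [R] is twice the number of inner edges. *)
Lemma card_inner E : E \in graphs -> #|inner E| = h.
Proof.
rewrite inE => /andP[/and3P[_ sg ind] /forallP dg].
have sumE (S : {set 'I_n}) : (M1 d S = \sum_(e in E) #|e :&: S|)%N.
  rewrite /M1; under eq_bigr => v _ do rewrite -(eqP (dg v)) /degree -sum1_card.
  under [RHS]eq_bigr => e _ do rewrite -sum1_card.
  rewrite (exchange_big_dep (mem E)) /=; last by move=> v e _; rewrite inE => /andP[].
  apply: eq_bigr => e eE; apply: eq_bigl => v; rewrite !inE eE /=.
  by rewrite andbC.
have : (\sum_(e in E) #|e :&: R| = \sum_(e in E) (#|e :&: L| + 2 * (e \subset R)))%N.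
  apply: eq_bigr => e eE; have [eR|[v [i [vR iL ->]]]] := edge_cases sg ind eE.
    rewrite eR (setIidPl eR) (eqP (forall_inP sg _ eE)).
    suff -> : e :&: L = finset.set0 by rewrite cards0.
    apply/setP => v; rewrite !inE; apply/andP => -[/(subsetP eR) vR vL].
    by rewrite notLR in vR.
  have -> : [set v; i] :&: R = [set v].
    apply/setP => x; rewrite !inE; case: (x =P v) => [->|_] //=.
    by case: (x =P i) => [->|_] //=; rewrite notLR.
  have -> : [set v; i] :&: L = [set i].
    apply/setP => x; rewrite !inE andb_orl orbC; case: (x =P i) => [->|_] /=; first by rewrite iL.
    by case: (x =P v) => [->|_] //=; apply/negP => /notLR; rewrite vR.
  rewrite !cards1; case: (boolP (_ \subset _)) => //= /subsetP /(_ i).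
  by rewrite set22 notLR // => /(_ isT).
rewrite -sumE big_split /= -sumE -big_distrr /= -hE => /addnI.
rewrite -mul2n => /eqP; rewrite eqn_mul2l /= => /eqP ->.
rewrite -sum1_card big_mkcond [RHS]big_mkcond /=; apply: eq_bigr => e _.
by rewrite inE; case: (e \in E) => //=; case: (_ \subset _).
Qed.

(** Degrees are left out on purpose: a graph rebuilt from a bigraph is shown to be [linked] first,
    and its degrees are then read off through [row_card] and [col_card]. *)
Definition linked E t := [/\ simple_graph E, independent E L, injective t & inner E = [set t k | k : 'I_h]].

Lemma linked_inner E t k : linked E t -> t k \in E /\ t k \subset R.
Proof.
case=> _ _ _ inn; have : t k \in inner E by rewrite inn imset_f.
by rewrite inE => /andP[].
Qed.

Lemma row_card E t v : linked E t -> v \in R ->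
  #|[set y | (v, y) \in to_bigraph (E, t)]| = degree E v.
Proof.
move=> lk vR; have [sg ind t_inj inn] := lk.
pose f (y : 'I_n + 'I_h) := match y with inl i => [set v; i] | inr k => t k end.
have inj : {in [set y | (v, y) \in to_bigraph (E, t)] &, injective f}.
  move=> [i|k] [i'|k']; rewrite !inE /=.
  - by move=> /and3P[_ iL _] /and3P[_ i'L _] /(cross_inj vR iL vR i'L)[_ ->].
  - move=> /and3P[_ iL _] _ E'; have [_ /subsetP /(_ i)] := linked_inner k' lk.
    by rewrite -E' set22 notLR // => /(_ isT).
  - move=> _ /and3P[_ iL _] E'; have [_ /subsetP /(_ i')] := linked_inner k lk.
    by rewrite E' set22 notLR // => /(_ isT).
  - by move=> _ _ /t_inj ->.
rewrite -(card_in_imset inj); apply: eq_card => e; rewrite [RHS]inE.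
apply/imsetP/andP => [[[i|k] + ->]|[eE ve]]; rewrite ?inE /=.
- by case/and3P => _ _ ->; rewrite eqxx.
- by have [-> _] := linked_inner k lk.
have [eR|[v' [i [v'R iL e_eq]]]] := edge_cases sg ind eE.
  have : e \in inner E by rewrite inE eE.
  by rewrite inn => /imsetP[k _ ek]; exists (inr k); rewrite // !inE /= -ek.
have vv' : v = v'.
  move: ve; rewrite e_eq !inE => /orP[/eqP //|/eqP vi].
  by rewrite vi notLR in vR.
by exists (inl i); rewrite ?inE /= vv' // v'R iL -e_eq.
Qed.

Lemma col_card E t i : linked E t -> i \in L ->
  #|nbr (to_bigraph (E, t)) (inl i)| = degree E i.
Proof.
move=> [sg ind t_inj inn] iL.
have inj : {in nbr (to_bigraph (E, t)) (inl i) &, injective (fun v => [set v; i])}.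
  move=> v v'; rewrite !inE /= => /and3P[vR _ _] /and3P[v'R _ _].
  by move=> /(cross_inj vR iL v'R iL)[-> _].
rewrite -(card_in_imset inj); apply: eq_card => e; rewrite [RHS]inE.
apply/imsetP/andP => [[v + ->]|[eE ie]].
  by rewrite !inE /= => /and3P[_ _ ->]; rewrite eqxx orbT.
have [eR|[v' [i' [v'R i'L e_eq]]]] := edge_cases sg ind eE.
  by move: (subsetP eR _ ie); rewrite notLR.
have ii' : i = i'.
  move: ie; rewrite e_eq !inE => /orP[/eqP vi|/eqP //].
  by rewrite -vi notLR in v'R.
by exists v'; rewrite ?inE /= ii' // v'R i'L -e_eq.
Qed.

Definition ordered_graphs : {set {set {set 'I_n}} * {ffun 'I_h -> {set 'I_n}}} :=
  [set z : {set {set 'I_n}} * {ffun 'I_h -> {set 'I_n}} | (z.1 \in graphs) && [forall k, z.2 k \in inner z.1] && injectiveb z.2].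

Lemma card_ordered_graphs : #|ordered_graphs| = (g L R d * h`!)%N.
Proof.
have -> : g L R d = #|graphs| by [].
rewrite -sum1_card (eq_bigl (fun z : {set {set 'I_n}} * {ffun 'I_h -> {set 'I_n}} => (z.1 \in graphs) &&
   [forall k, z.2 k \in inner z.1] && injectiveb z.2)); last by move=> z; rewrite inE.
under eq_bigl do rewrite -andbA.
rewrite -(pair_big_dep (fun E => E \in graphs)
  (fun E t => [forall k, t k \in inner E] && injectiveb t) (fun _ _ => 1%N)) /=.
rewrite -sum_nat_const; apply: eq_bigr => E Eg.
have := card_inj_ffuns_on 'I_h (mem (inner E)); rewrite card_inner // card_ord ffactnn => <-.
rewrite -sum1_card; apply: eq_bigl => t; rewrite [RHS]inE; congr andb.
Qed.

Lemma linked_ordered z : z \in ordered_graphs -> linked z.1 z.2.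
Proof.
rewrite inE => /andP[/andP[zg /forallP inn] /injectiveP t_inj].
have := zg; rewrite inE => /andP[/and3P[_ sg ind] _]; split => //.
apply/esym/eqP; rewrite eqEcard card_imset // card_inner // card_ord leqnn andbT.
by apply/subsetP => _ /imsetP[k _ ->].
Qed.

Lemma to_bigraph_inj : {in ordered_graphs &, injective to_bigraph}.
Proof.
move=> [E t] [E' t'] /linked_ordered /= lk /linked_ordered /= lk' eqB.
have memB p : p \in to_bigraph (E, t) = (p \in to_bigraph (E', t')) by rewrite eqB.
have tt' : t = t'.
  by apply/ffunP => k; apply/setP => v; have := memB (v, inr k); rewrite !inE.
rewrite -{}tt' in lk' memB *; congr pair.
suff sub E1 E2 : linked E1 t -> linked E2 t ->
    (forall p, p \in to_bigraph (E1, t) -> p \in to_bigraph (E2, t)) -> E1 \subset E2.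
  by apply/eqP; rewrite eqEsubset !sub // => p; rewrite memB.
move=> lk1 lk2 s12; apply/subsetP => e eE; have [sg ind _ inn] := lk1.
have [eR|[v [i [vR iL e_eq]]]] := edge_cases sg ind eE.
  have : e \in inner E1 by rewrite inE eE.
  by rewrite inn => /imsetP[k _ ->]; have [] := linked_inner k lk2.
have := s12 (v, inl i); rewrite !inE /= vR iL -e_eq eE => /(_ isT).
by [].
Qed.

Lemma to_bigraph_good z : z \in ordered_graphs -> to_bigraph z \in good_bigraphs.
Proof.
move=> zo; have lk := linked_ordered zo; have [sg _ t_inj _] := lk.
case: z zo lk sg t_inj => E t /= zo lk /forall_inP sg t_inj.
have dg i : degree E i = d i.
  by move: zo; rewrite !inE => /andP[/andP[/andP[_ /forallP /(_ i) /eqP]]].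
have nk k : nbr (to_bigraph (E, t)) (inr k) = t k by apply/setP => v; rewrite !inE.
rewrite inE; apply/and3P; split.
- apply/forallP => v; rewrite /row_degree; case: ifP => vR; first by rewrite row_card // dg.
  rewrite cards_eq0; apply/eqP/setP => -[i|k]; rewrite !inE /= ?vR //.
  have [_ /subsetP /(_ v)] := linked_inner k lk; rewrite vR.
  by case: (v \in t k) => // /(_ isT).
- apply/forallP => -[i|k] /=; last by rewrite nk sg //; have [] := linked_inner k lk.
  case: ifP => iL; first by rewrite col_card // dg.
  by rewrite cards_eq0; apply/eqP/setP => v; rewrite !inE /= iL andbF.
- apply/'forall_forallP => k l; apply/implyP; apply: contra => /eqP.
  by rewrite !nk => /t_inj ->.
Qed.

Lemma to_bigraph_onto B : B \in good_bigraphs ->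
  exists2 z, z \in ordered_graphs & B = to_bigraph z.
Proof.
rewrite inE => /and3P[/forallP hrow /forallP hcol /'forall_forallP htwin].
have rowR v y : (v, y) \in B -> v \in R.
  move=> vy; have := hrow v; rewrite /row_degree; case: ifP => // _.
  by rewrite cards_eq0 => /eqP /setP /(_ y); rewrite !inE vy.
have colL v i : (v, inl i) \in B -> i \in L.
  move=> vi; have := hcol (inl i); rewrite /=; case: ifP => // _.
  by rewrite cards_eq0 => /eqP /setP /(_ v); rewrite !inE vi.
pose t := [ffun k : 'I_h => nbr B (inr k)].
pose E := [set [set p.1; p.2] | p in [set p : 'I_n * 'I_n | (p.1, inl p.2) \in B]]
   :|: [set t k | k : 'I_h].
have EP e : e \in E -> (exists v i, (v, inl i) \in B /\ e = [set v; i]) \/ (exists k, e = t k).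
  rewrite inE => /orP[/imsetP[[v i]]|/imsetP[k _ ->]]; last by right; exists k.
  by rewrite inE /= => vi ->; left; exists v, i.
have tR k : t k \subset R by apply/subsetP => v; rewrite ffunE inE; apply: rowR.
have tE k : t k \in E by rewrite inE imset_f ?orbT.
have crossE v i : (v, inl i) \in B -> [set v; i] \in E.
  by move=> vi; rewrite inE; apply/orP; left; apply/imsetP; exists (v, i); rewrite ?inE.
have neq v i : (v, inl i) \in B -> v != i.
  by move=> vi; apply/eqP => E'; move: (colL _ _ vi) (rowR _ _ vi); rewrite E' => /notLR ->.
have sg : simple_graph E.
  apply/forall_inP => e /EP[[v [i [vi ->]]]|[k ->]]; first by rewrite cards2 neq.
  by rewrite ffunE; have := hcol (inr k).
have ind : independent E L.
  apply/forall_inP => x xL; apply/forall_inP => y yL; apply/negP => /EP[[v [i [vi E']]]|[k E']].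
    have : v \in [set x; y] by rewrite E' set21.
    by have := rowR _ _ vi; rewrite !inE => + /orP[]/eqP vx; rewrite vx notLR.
  by have := subsetP (tR k) x; rewrite -E' set21 notLR // => /(_ isT).
have t_inj : injective t.
  move=> k l; rewrite !ffunE => E'; apply/eqP; have := htwin k l.
  by rewrite E' eqxx implybF negbK.
have inn : inner E = [set t k | k : 'I_h].
  apply/setP => e; rewrite inE; apply/andP/imsetP => [[/EP[[v [i [vi ->]]]|[k ->]] eR]|[k _ ->]].
  - by have := subsetP eR i; rewrite set22 notLR ?(colL _ _ vi) // => /(_ isT).
  - by exists k.
  - by [].
have lk : linked E t by [].
have BE : B = to_bigraph (E, t).
  apply/setP => -[v [i|k]]; rewrite [RHS]inE /=; last by rewrite ffunE inE.
  apply/idP/and3P => [vi|[vR iL /EP[[v' [i' [vi' E']]]|[k E']]]].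
  - by split; [exact: rowR vi|exact: colL vi|exact: crossE].
  - by have [-> ->] := cross_inj vR iL (rowR _ _ vi') (colL _ _ vi') E'.
  - by have := subsetP (tR k) i; rewrite -E' set22 notLR // => /(_ isT).
exists (E, t) => //; rewrite !inE /=; apply/andP; split; last exact/injectiveP.
apply/andP; split; last by apply/forallP => k; rewrite inE tE tR.
rewrite /B_graph bip sg ind /=; apply/forallP => i.
have [iR|/LR iL] := boolP (i \in R).
  by rewrite -(row_card lk) // -BE (eqP (hrow i)) /row_degree iR.
by rewrite -(col_card lk) // -BE (eqP (hcol (inl i))) /= iL.
Qed.

Lemma card_good_bigraphs : #|good_bigraphs| = (g L R d * h`!)%N.
Proof.
rewrite -card_ordered_graphs -(card_in_imset to_bigraph_inj); apply: eq_card => B.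
apply/idP/imsetP => [/to_bigraph_onto[z zo ->]|[z zo ->]]; first by exists z.
exact: to_bigraph_good.
Qed.

End GraphsAndBigraphs.

(** * Counting forbidden patterns *)

Lemma card_dep_pairs (U V : finType) (P : {set U}) (Q : U -> {set V}) (m k : nat) :
  (#|P| <= m)%N -> (forall x, x \in P -> (#|Q x| <= k)%N) ->
  (#|[set z : U * V | (z.1 \in P) && (z.2 \in Q z.1)]| <= m * k)%N.
Proof.
move=> Pm Qk; rewrite -sum1_card.
rewrite (eq_bigl (fun z : U * V => (z.1 \in P) && (z.2 \in Q z.1))) => [|z]; last by rewrite inE.
rewrite -(pair_big_dep (fun x => x \in P) (fun x y => y \in Q x) (fun _ _ => 1%N)) /=.
apply: (@leq_trans (\sum_(x in P) k)%N).
  by apply: leq_sum => x xP; rewrite sum1_card Qk.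
by rewrite sum_nat_const leq_mul2r Pm orbT.
Qed.

Section PatternCounts.
Variables (T X Y : finType) (rho : T -> X) (lam : T -> Y) (slot : pred Y).
Hypothesis slot2 : forall k, slot k -> #|[set c | lam c == k]| = 2%N.
Implicit Types (p q : T * T) (F Q : {set T * T}).

Local Notation par := (par rho lam).
Local Notation quad := (quad rho lam slot).
Local Notation double_edges := (double_edges rho lam).
Local Notation twin_slots := (twin_slots rho lam slot).

Lemma quad_flip p1 p2 p3 p4 : quad p1 p2 p3 p4 -> quad p2 p1 p4 p3.
Proof.
case/and5P => r13 r24 r12 n13 /and5P[n24 /eqP l12 /eqP l34 m12 /and4P[m34 l13 k1 k2]].
apply/and5P; split => //; first by rewrite eq_sym.
apply/and5P; split => //; [by rewrite l12|by rewrite l34|by rewrite eq_sym|].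
by rewrite eq_sym m34 -l12 -l34 l13 k1 k2.
Qed.

Lemma quad_swap p1 p2 p3 p4 : quad p1 p2 p3 p4 -> quad p3 p4 p1 p2.
Proof.
case/and5P => /eqP r13 /eqP r24 r12 n13 /and5P[n24 l12 l34 m12 /and4P[m34 l13 k1 k2]].
apply/and5P; split; rewrite ?r13 ?r24 //; first by rewrite -r13 -r24.
  by rewrite eq_sym.
by apply/and5P; split => //; [rewrite eq_sym|rewrite m12 eq_sym l13 k1 k2].
Qed.

(** Inside the set of a quad, the partner of an entry in its slot and its partner at its vertex are
    unique, so the first entry fixes the order. Each set therefore has exactly four orderings,
    generated by [quad_flip] and [quad_swap]. *)
Lemma quad_from_first p1 p2 p3 p4 z2 z3 z4 : quad p1 p2 p3 p4 -> quad p1 z2 z3 z4 ->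
  {subset [:: z2; z3; z4] <= [:: p1; p2; p3; p4]} -> [/\ z2 = p2, z3 = p3 & z4 = p4].
Proof.
move=> qp qz sub.
have /andP[_ up] := quad_uniq qp; have /andP[uz _] := quad_uniq qz.
have {}uz := map_uniq uz.
case/and5P: qp => /eqP r13 /eqP r24 /negPf r12 n13 /and5P[n24 /eqP l12 /eqP l34 m12 /and4P[m34 /negPf l13 k1 k2]].
case/and5P: qz => /eqP s13 /eqP s24 /negPf s12 _ /and5P[_ /eqP t12 /eqP t34 _ /and4P[_ /negPf t13 _ _]].
move: uz; rewrite /= !inE !negb_or => /and4P[/and3P[n1 n2 n3] /andP[n4 n5] n6 _].
have := sub z2; rewrite inE eqxx => /(_ isT); rewrite !inE eq_sym (negPf n1) /=.
case/or3P => /eqP z2E; last first.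
- by move: l13; rewrite t12 z2E l34 eqxx.
- by move: l13; rewrite t12 z2E eqxx.
have : z3 \in [:: p1; p2; p3; p4] by apply: sub; rewrite !inE eqxx orbT.
rewrite !inE [z3 == p1]eq_sym (negPf n2) /=.
case/or3P => /eqP z3E; last first.
- by move: r12; rewrite s13 z3E -r24 eqxx.
- split => //; have : z4 \in [:: p1; p2; p3; p4] by apply: sub; rewrite !inE eqxx !orbT.
  rewrite !inE -z2E -z3E ![z4 == _]eq_sym (negPf n3) (negPf n5) (negPf n6) /=.
  by move/eqP.
- by move: n4; rewrite z2E z3E eqxx.
Qed.

Lemma twin_slots_through F q : F \in twin_slots -> q \in F ->
  exists p2 p3 p4, quad q p2 p3 p4 /\ F = [set x in [:: q; p2; p3; p4]].
Proof.
case/twin_slotsP => p1 [p2 [p3 [p4 [qd ->]]]]; rewrite !inE => /or4P[]/eqP ->.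
- by exists p2, p3, p4.
- exists p1, p4, p3; split; first exact: quad_flip.
  by apply/setP => x; rewrite !inE; do 4! case: (_ == _).
- exists p4, p1, p2; split; first exact: quad_swap.
  by apply/setP => x; rewrite !inE; do 4! case: (_ == _).
- exists p3, p2, p1; split; first exact/quad_swap/quad_flip.
  by apply/setP => x; rewrite !inE; do 4! case: (_ == _).
Qed.

Lemma card_par : (#|[set z : (T * T) * (T * T) | par z.1 z.2]| = #|double_edges| * 2)%N.
Proof.
rewrite -sum1_card (partition_big_imset (fun z => [set p in [:: z.1; z.2]])) /=.
rewrite -sum_nat_const; apply: eq_bigr => F /double_edgesP[p [q [pq ->]]].
have npq : p != q by apply: contraTneq pq => ->; rewrite par_irrefl.
rewrite sum1_card; transitivity #|[set (p, q); (q, p)]|; last first.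
  by rewrite cards2 xpair_eqE (negPf npq).
apply: eq_card => -[x y]; rewrite [LHS]inE /= [in LHS]inE /=; apply/andP/idP.
  move=> [xy /eqP E]; have nxy : x != y by apply: contraTneq xy => ->; rewrite par_irrefl.
  have /setP /(_ x) := E; have /setP /(_ y) := E; rewrite !inE !eqxx orbT /=.
  case/esym/orP => /eqP yE; case/esym/orP => /eqP xE; rewrite xE yE ?eqxx ?orbT //.
  - by rewrite xE yE eqxx in nxy.
  - by rewrite xE yE eqxx in nxy.
rewrite !inE !xpair_eqE => /orP[]/andP[/eqP -> /eqP ->]; split => //.
  by rewrite par_sym.
by apply/eqP/setP => z; rewrite !inE; do 2! case: (_ == _).
Qed.

Lemma card_quad :
  (#|[set z : ((T * T) * (T * T)) * ((T * T) * (T * T)) | quad z.1.1 z.1.2 z.2.1 z.2.2]|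
   = #|twin_slots| * 4)%N.
Proof.
rewrite -sum1_card (partition_big_imset (fun z => [set p in [:: z.1.1; z.1.2; z.2.1; z.2.2]])) /=.
rewrite -sum_nat_const; apply: eq_bigr => F /twin_slotsP[p1 [p2 [p3 [p4 [qd ->]]]]].
pose l := [:: ((p1, p2), (p3, p4)); ((p2, p1), (p4, p3)); ((p3, p4), (p1, p2)); ((p4, p3), (p2, p1))].
have ul : uniq l.
  have /andP[/map_uniq u _] := quad_uniq qd.
  move: u; rewrite /l /= !inE !xpair_eqE !negb_or => /and4P[/and3P[a1 a2 a3] /andP[a4 a5] a6 _].
  by rewrite (negPf a1) (negPf a2) (negPf a3) (negPf a4) (negPf a5) (negPf a6).
rewrite sum1_card -[4%N]/(size l) -(card_uniq_seq ul).
apply: eq_card => -[[z1 z2] [z3 z4]]; rewrite [LHS]inE /= [in LHS]inE /= inE; apply/andP/idP.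
  move=> [qz /eqP E].
  have sub z : z \in [:: z1; z2; z3; z4] -> z \in [:: p1; p2; p3; p4].
    by move=> h; have /setP /(_ z) := E; rewrite !in_set h => <-.
  have sub' : {subset [:: z2; z3; z4] <= [:: p1; p2; p3; p4]}.
    by move=> z h; apply: sub; rewrite inE h orbT.
  have := sub z1; rewrite mem_head => /(_ isT); rewrite !inE => /or4P[]/eqP z1E; subst z1.
  - by have [-> -> ->] := quad_from_first qd qz sub'; rewrite !eqxx.
  - have [z|-> -> ->] := quad_from_first (quad_flip qd) qz _; last by rewrite !eqxx ?orbT.
    by move/sub'; rewrite !inE; do 4! case: (_ == _).
  - have [z|-> -> ->] := quad_from_first (quad_swap qd) qz _; last by rewrite !eqxx ?orbT.
    by move/sub'; rewrite !inE; do 4! case: (_ == _).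
  - have [z|-> -> ->] := quad_from_first (quad_swap (quad_flip qd)) qz _; last by rewrite !eqxx ?orbT.
    by move/sub'; rewrite !inE; do 4! case: (_ == _).
rewrite !inE !xpair_eqE => /or4P[]/andP[/andP[/eqP -> /eqP ->] /andP[/eqP -> /eqP ->]]; split=> //.
- exact: quad_flip.
- by apply/eqP/setP => z; rewrite !inE; do 4! case: (_ == _).
- exact: quad_swap.
- by apply/eqP/setP => z; rewrite !inE; do 4! case: (_ == _).
- exact/quad_flip/quad_swap.
- by apply/eqP/setP => z; rewrite !inE; do 4! case: (_ == _).
Qed.

(** * Patterns through given entries *)

Variable D : nat.
Hypothesis D0 : (0 < D)%N.
Hypothesis rhoD : forall x, (#|[set a | rho a == x]| <= D)%N.
Hypothesis lamD : forall y, (#|[set c | lam c == y]| <= 2 * D)%N.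
Let N := #|T|.

Let rf a := [set b | rho b == rho a].
Let cf c := [set b | lam b == lam c].

Let card_rect (A B : {set T}) m k : (#|A| <= m)%N -> (#|B| <= k)%N -> (#|setX A B| <= m * k)%N.
Proof. by move=> h1 h2; rewrite cardsX leq_mul. Qed.

Let slot_cf c : slot (lam c) -> (#|cf c| <= 2)%N.
Proof. by move=> /slot2 <-. Qed.

Let card_T (A : {set T}) : (#|A| <= N)%N.
Proof. exact: max_card. Qed.

Lemma count_double_edges p : (#|[set F in double_edges | p \in F]| <= 2 * D ^ 2)%N.
Proof.
apply: (@leq_trans #|[set [set x in [:: p; q]] | q in setX (rf p.1) (cf p.2)]|).
  apply/subset_leq_card/subsetP => F; rewrite inE => /andP[/double_edgesP[x [y [xy ->]]]].
  case/and4P: xy => r l _ _; rewrite !inE => /orP[]/eqP ->.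
    by apply/imsetP; exists y; rewrite // !inE eq_sym r eq_sym l.
  apply/imsetP; exists x; first by rewrite !inE r l.
  by apply/setP => z; rewrite !inE orbC.
apply: leq_trans (leq_imset_card _ _) _.
by apply: leq_trans (card_rect (rhoD _) (lamD _)) _; nia.
Qed.

(** Choose [p2] in the slot of [q] ([2 * N] ways), [p3] at the vertex of [q] ([D * N]), then [p4] at
    the vertex of [p2] in the slot of [p3] ([2 * D]). Remembering that [p3] lies in a slot is what
    gives 2 columns instead of [2 * D] for [p4]. *)
Lemma count_twin_slots1 q : (#|[set F in twin_slots | q \in F]| <= 4 * (D ^ 2 * N ^ 2))%N.
Proof.
have [->|/set0Pn[F0]] := eqVneq [set F in twin_slots | q \in F] finset.set0; first by rewrite cards0.
rewrite inE => /andP[F0t qF0].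
have slq : slot (lam q.2) by have [? [? [? [/and5P[_ _ _ _ /and5P[_ _ _ _ /and4P[_ _ ? _]]] _]]]] := twin_slots_through F0t qF0.
pose P := [set z : (T * T) * (T * T) | (z.1 \in setX [set: T] (cf q.2)) &&
  (z.2 \in [set p in setX (rf q.1) [set: T] | slot (lam p.2)])].
pose Q (z : (T * T) * (T * T)) := setX (rf z.1.1) (cf z.2.2).
pose Z := [set z | (z.1 \in P) && (z.2 \in Q z.1)].
apply: (@leq_trans #|[set [set x in [:: q; z.1.1; z.1.2; z.2]] | z in Z]|).
  apply/subset_leq_card/subsetP => F; rewrite inE => /andP[Ft qF].
  have [p2 [p3 [p4 [qd ->]]]] := twin_slots_through Ft qF.
  apply/imsetP; exists ((p2, p3), p4) => //; rewrite !inE /=.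
  case/and5P: qd => r13 r24 _ _ /and5P[_ l12 l34 _ /and4P[_ _ _ ->]].
  by rewrite eq_sym l12 eq_sym r13 eq_sym r24 eq_sym l34.
apply: leq_trans (leq_imset_card _ _) _.
apply: (@leq_trans (((N * 2) * (D * N)) * (D * 2))%N); last by nia.
apply: card_dep_pairs => [|z]; first apply: (@card_dep_pairs _ _ _ (fun=> [set p in setX (rf q.1) [set: T] | slot (lam p.2)])).
- by apply: card_rect; [apply: card_T|apply: slot_cf].
- move=> x _; apply: (@leq_trans #|setX (rf q.1) [set: T]|); last by apply: card_rect; [apply: rhoD|apply: card_T].
  by apply: subset_leq_card; apply/subsetP => z; rewrite !inE => /andP[].
rewrite inE => /andP[_]; rewrite inE => /andP[_ sl].
by apply: card_rect; [apply: rhoD|apply: slot_cf].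
Qed.

(** [Z1], [Z2] and [Z3] are the cases that [q'] shares the slot of [q], its vertex, or neither; in
    the last both missing entries are confined to [2 * D] places. *)
Lemma count_twin_slots2 q q' : q != q' ->
  (#|[set F in twin_slots | (q \in F) && (q' \in F)]| <= 10 * (D ^ 2 * N))%N.
Proof.
move=> nqq'.
set S := [set F in _ | _].
have [->|/set0Pn[F0]] := eqVneq S finset.set0; first by rewrite cards0.
rewrite inE => /and3P[F0t qF0 q'F0].
have slq : slot (lam q.2) by have [? [? [? [/and5P[_ _ _ _ /and5P[_ _ _ _ /and4P[_ _ ? _]]] _]]]] := twin_slots_through F0t qF0.
have slq' : slot (lam q'.2) by have [? [? [? [/and5P[_ _ _ _ /and5P[_ _ _ _ /and4P[_ _ ? _]]] _]]]] := twin_slots_through F0t q'F0.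
pose Z1 := [set z : (T * T) * (T * T) | (z.1 \in [set p in setX (rf q.1) [set: T] | slot (lam p.2)])
   && (z.2 \in setX (rf q'.1) (cf z.1.2))].
pose Z2 := [set z : (T * T) * (T * T) | (z.1 \in setX [set: T] (cf q.2))
   && (z.2 \in setX (rf z.1.1) (cf q'.2))].
pose Z3 := [set z : (T * T) * (T * T) | (z.1 \in setX (rf q'.1) (cf q.2))
   && (z.2 \in setX (rf q.1) (cf q'.2))].
have N0 : (0 < N)%N by apply/card_gt0P; exists q.1.
apply: (@leq_trans #|([set [set x in [:: q; q'; z.1; z.2]] | z in Z1] :|:
   [set [set x in [:: q; z.1; q'; z.2]] | z in Z2]) :|:
   [set [set x in [:: q; z.1; z.2; q']] | z in Z3]|).
  apply/subset_leq_card/subsetP => F; rewrite inE => /and3P[Ft qF q'F].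
  have [p2 [p3 [p4 [qd FE]]]] := twin_slots_through Ft qF.
  move: q'F; rewrite FE !inE [q' == q]eq_sym (negPf nqq') /=.
  case/and5P: qd => r13 r24 _ _ /and5P[_ l12 l34 _ /and4P[_ _ _ sl3]].
  case/or3P => /eqP E; rewrite -{}E in r24 r13 l12 l34 sl3 *.
  - apply/orP; left; apply/orP; left; apply/imsetP; exists (p3, p4) => //.
    by rewrite !inE /= eq_sym r13 sl3 eq_sym r24 eq_sym l34.
  - apply/orP; left; apply/orP; right; apply/imsetP; exists (p2, p4) => //.
    by rewrite !inE /= eq_sym l12 eq_sym r24 eq_sym l34.
  - apply/orP; right; apply/imsetP; exists (p2, p3) => //.
    by rewrite !inE /= r24 eq_sym l12 eq_sym r13 l34.
apply: leq_trans (leq_card_setU _ _).1 _.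
apply: (@leq_trans ((D * N) * (D * 2) + (N * 2) * (D * 2) + (D * 2) * (D * 2))%N); last first.
  have DN : (D <= D * N)%N by rewrite leq_pmulr.
  have h1 : (D * N <= D ^ 2 * N)%N by rewrite leq_mul2r orbC -{1}[D]expn1 leq_pexp2l.
  have h2 : (D ^ 2 <= D ^ 2 * N)%N by rewrite leq_pmulr.
  by move: h1 h2; rewrite !expnS expn0 !muln1; nia.
apply: leq_add; first apply: leq_trans (leq_card_setU _ _).1 (leq_add _ _).
- apply: leq_trans (leq_imset_card _ _) _; apply: (@card_dep_pairs _ _ _ (fun x => setX (rf q'.1) (cf x.2))).
    apply: (@leq_trans #|setX (rf q.1) [set: T]|); last by apply: card_rect; [apply: rhoD|apply: card_T].
    by apply: subset_leq_card; apply/subsetP => z; rewrite !inE => /andP[].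
  move=> z; rewrite inE => /andP[_ sl].
  by apply: card_rect; [apply: rhoD|apply: slot_cf].
- apply: leq_trans (leq_imset_card _ _) _; apply: (@card_dep_pairs _ _ _ (fun x => setX (rf x.1) (cf q'.2))).
    by apply: card_rect; [apply: card_T|apply: slot_cf].
  by move=> z _; apply: card_rect; [apply: rhoD|apply: slot_cf].
- apply: leq_trans (leq_imset_card _ _) _; apply: (@card_dep_pairs _ _ _ (fun=> setX (rf q.1) (cf q'.2))) => [|z _].
    by apply: card_rect; [apply: rhoD|apply: slot_cf].
  by apply: card_rect; [apply: rhoD|apply: slot_cf].
Qed.

(** The missing entry shares its vertex with one entry of [Q] and its slot with another: at most 9
    pairs, with [2 * D] places each. *)
Lemma count_twin_slots3 Q : #|Q| = 3%N ->
  (#|[set F in twin_slots | Q \subset F]| <= 18 * D)%N.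
Proof.
move=> Q3.
pose Z := \bigcup_(z in setX Q Q | slot (lam z.2.2)) setX (rf z.1.1) (cf z.2.2).
apply: (@leq_trans #|[set x |: Q | x in Z]|); last first.
  apply: leq_trans (leq_imset_card _ _) _; apply: leq_trans (leq_card_bigcup _ _) _.
  apply: (@leq_trans (\sum_(z in setX Q Q) D * 2)%N).
    rewrite big_mkcondr /=; apply: leq_sum => z _; case: ifP => // sl.
    by apply: card_rect; [apply: rhoD|apply: slot_cf].
  by rewrite sum_nat_const cardsX Q3; nia.
apply/subset_leq_card/subsetP => F; rewrite inE => /andP[Ft QF].
have cF : #|F :\: Q| = 1%N by rewrite cardsD (setIidPr QF) Q3 (card_twin_slots Ft).
have [x xE] := cards1P (introT eqP cF).
have xF : x \in F by have := set11 x; rewrite -xE inE => /andP[].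
have FE : F = x |: Q by rewrite -(setID F Q) (setIidPr QF) xE setUC.
have inQ y : y \in F -> y != x -> y \in Q by rewrite FE !inE => /orP[->|].
apply/imsetP; exists x => //.
have [p2 [p3 [p4 [qd E]]]] := twin_slots_through Ft xF.
have /andP[/map_uniq u _] := quad_uniq qd.
move: u; rewrite /= !inE !negb_or => /and4P[/and3P[a1 a2 a3] _ _ _].
case/and5P: qd => r13 r24 _ _ /and5P[_ l12 l34 _ /and4P[_ _ sl _]].
apply/bigcupP; exists (p3, p2); last by rewrite !inE /= r13 l12.
rewrite !inE /= -(eqP l12) sl andbT; apply/andP; split; apply: inQ; rewrite ?E ?inE ?eqxx ?orbT //.
  by rewrite eq_sym.
by rewrite eq_sym.
Qed.

(** Each missing entry weighs [1 / N], and the counts for 1, 2, 3 given entries grow like [N ^ 2],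
    [N], 1, so one factor [1 / N] always survives. The 20 is 2 for double edges plus the largest
    constant, 18, for twin slots. *)
Lemma forbidden_sparse (R : realType) Q : Q != finset.set0 ->
  (\sum_(F in forbidden rho lam slot | Q \proper F) (N%:R^-1) ^+ (#|F| - #|Q|)
    <= 20 * (D ^ 2)%:R * N%:R^-1 :> R)%R.
Proof.
move=> /set0Pn[q0 q0Q].
have N0 : (0 < N)%N by apply/card_gt0P; exists q0.1.
set iN : R := (N%:R^-1)%R.
have iN0 : (0 < iN)%R by rewrite invr_gt0 ltr0n.
have iN1 : (iN <= 1)%R by rewrite invf_le1 ?ltr0n // ler1n.
have NiN : (N%:R * iN = 1)%R by rewrite mulfV // pnatr_eq0 -lt0n.
have D1 : (D <= D ^ 2)%N by rewrite -{1}[D]expn1 leq_pexp2l.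
have count_le (A : {set {set T * T}}) (m : nat) (x : R) k : (0 <= x)%R ->
    (forall F, F \in A -> Q \proper F -> (iN ^+ (#|F| - #|Q|) <= x)%R) ->
    (#|[set F in A | Q \proper F]| <= m)%N -> (m%:R * x <= k)%R ->
    (\sum_(F in A | Q \proper F) iN ^+ (#|F| - #|Q|) <= k)%R.
  move=> x0 hx hm hk; apply: le_trans hk.
  apply: (@le_trans _ _ (\sum_(F in [set F in A | Q \proper F]) x)%R); last first.
    by rewrite sumr_const -[leLHS]mulr_natl ler_wpM2r // ler_nat.
  under [leRHS]eq_bigl => F do rewrite inE.
  by apply: ler_sum => F /andP[]; apply: hx.
apply: (@le_trans _ _ (\sum_(F in double_edges | Q \proper F) iN ^+ (#|F| - #|Q|)
    + \sum_(F in twin_slots | Q \proper F) iN ^+ (#|F| - #|Q|))%R).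
  rewrite !big_mkcondr big_mkcond [X in (_ <= X + _)%R]big_mkcond [X in (_ <= _ + X)%R]big_mkcond /=.
  rewrite -big_split /=; apply: ler_sum => F _; rewrite inE.
  have pos (b c : bool) k : (0 <= (if b then (if c then iN ^+ k else 0) else 0))%R.
    by case: b; case: c => //; rewrite exprn_ge0 // ltW.
  case: (F \in double_edges) => /=; last by rewrite add0r.
  by rewrite lerDl pos.
have DiN : (0 <= (D ^ 2)%:R * iN)%R by rewrite mulr_ge0 // ltW.
suff h2 : (\sum_(F in twin_slots | Q \proper F) iN ^+ (#|F| - #|Q|) <= 18 * ((D ^ 2)%:R * iN))%R.
  apply: (@le_trans _ _ (2 * ((D ^ 2)%:R * iN) + 18 * ((D ^ 2)%:R * iN))%R).
    apply: lerD h2; apply: (count_le _ (2 * D ^ 2)%N iN); first exact: ltW.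
    - move=> F /card_double_edge F2 /proper_card; rewrite F2 => Q2.
      have -> : (2 - #|Q|)%N = (1 - #|Q|).+1 by lia.
      rewrite exprS ler_piMr //; first exact: ltW.
      by rewrite exprn_ile1 // ltW.
    - apply: leq_trans (count_double_edges q0); apply/subset_leq_card/subsetP => F.
      by rewrite !inE => /andP[-> /proper_sub /subsetP ->].
    - by rewrite natrM mulrA.
  by rewrite -mulrDl -mulrA ler_wpM2r // -natrD.
have [Q4|Q4] := leqP 4 #|Q|.
  rewrite big1 => [|F /andP[/card_twin_slots F4 /proper_card]]; first by rewrite mulr_ge0.
  by rewrite F4 ltnNge Q4.
have Q0 : (0 < #|Q|)%N by apply/card_gt0P; exists q0.
have key m : (#|[set F in twin_slots | Q \proper F]| <= m)%N ->
    (m%:R * iN ^+ (4 - #|Q|) <= 18 * ((D ^ 2)%:R * iN))%R ->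
    (\sum_(F in twin_slots | Q \proper F) iN ^+ (#|F| - #|Q|) <= 18 * ((D ^ 2)%:R * iN))%R.
  move=> hm; apply: count_le hm; first by rewrite exprn_ge0 // ltW.
  by move=> F /card_twin_slots ->.
have [Q1|Q1] := eqVneq #|Q| 1%N.
  apply: (key (4 * (D ^ 2 * N ^ 2))%N).
    apply: leq_trans (count_twin_slots1 q0); apply/subset_leq_card/subsetP => F.
    by rewrite !inE => /andP[-> /proper_sub /subsetP ->].
  rewrite Q1 (natrM _ 4) (natrM _ (D ^ 2) (N ^ 2)) (natrX _ N 2) subSS subn0.
  have -> : (4 * ((D ^ 2)%:R * N%:R ^+ 2) * iN ^+ 3 = 4 * ((D ^ 2)%:R * iN) * (N%:R * iN) ^+ 2)%R by ring.
  by rewrite NiN expr1n mulr1 ler_wpM2r // ler_nat.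
have [Q2|Q2] := eqVneq #|Q| 2%N.
  have [q1 [q2 [nq QE]]] := cards2P _ (introT eqP Q2).
  apply: (key (10 * (D ^ 2 * N))%N).
    apply: leq_trans (count_twin_slots2 nq); apply/subset_leq_card/subsetP => F.
    rewrite !inE => /andP[-> /proper_sub /subsetP sQ].
    by rewrite !sQ // QE !inE eqxx ?orbT.
  rewrite Q2 (natrM _ 10) (natrM _ (D ^ 2) N) !subSS subn0.
  have -> : (10 * ((D ^ 2)%:R * N%:R) * iN ^+ 2 = 10 * ((D ^ 2)%:R * iN) * (N%:R * iN))%R by ring.
  by rewrite NiN mulr1 ler_wpM2r // ler_nat.
have Q3 : #|Q| = 3%N by move: Q4 Q0 Q1 Q2; case: #|Q| => [|[|[|[|]]]].
apply: (key (18 * D)%N).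
  apply: leq_trans (count_twin_slots3 Q3); apply/subset_leq_card/subsetP => F.
  by rewrite !inE => /andP[-> /proper_sub ->].
rewrite Q3 natrM !subSS subn0 expr1 -mulrA ler_pM2l // ler_pM2r // ler_nat.
exact: D1.
Qed.

End PatternCounts.

(** * Exact numbers of patterns *)

Definition same_pairs (T X : finType) (f : T -> X) : {set T * T} :=
  [set z | (f z.1 == f z.2) && (z.1 != z.2)].

Lemma card_same_pairs_fibre (T X : finType) (f : T -> X) x :
  #|[set z in same_pairs f | f z.1 == x]| =
  (#|[set a | f a == x]| * (#|[set a | f a == x]| - 1))%N.
Proof.
set A := [set a | f a == x].
have -> : [set z in same_pairs f | f z.1 == x] =
    [set z : T * T | (z.1 \in A) && (z.2 \in A :\ z.1)].
  apply/setP => -[a b]; rewrite !inE /= [a == b]eq_sym.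
  by case: (f a =P x) => [->|_]; rewrite ?andbF // andbT andbC [x == _]eq_sym.
rewrite -sum1_card (eq_bigl (fun z : T * T => (z.1 \in A) && (z.2 \in A :\ z.1))) => [|z]; last by rewrite inE.
rewrite -(pair_big_dep (fun a => a \in A) (fun a b => b \in A :\ a) (fun _ _ => 1%N)) /=.
rewrite -sum_nat_const; apply: eq_bigr => a aA; rewrite sum1_card.
by rewrite (cardsD1 a A) aA add1n subn1.
Qed.

Lemma card_key_fibres (U V : finType) (P : {set U}) (key : U -> V) :
  (#|P| = \sum_v #|[set u in P | key u == v]|)%N.
Proof.
rewrite -sum1_card (partition_big key predT) //=; apply: eq_bigr => v _.
by rewrite -sum1_card; apply: eq_bigl => u; rewrite inE.
Qed.

Lemma card_same_pairs (T X : finType) (f : T -> X) :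
  #|same_pairs f| = (\sum_x #|[set a | f a == x]| * (#|[set a | f a == x]| - 1))%N.
Proof.
rewrite (card_key_fibres _ (fun z => f z.1)); apply: eq_bigr => x _.
exact: card_same_pairs_fibre.
Qed.

(** A quad consists of two row pairs at different vertices and two column pairs in different slots,
    so pairs of pairs with a common key have to be removed. *)
Definition split_pairs (U V : finType) (P : {set U}) (key : U -> V) : {set U * U} :=
  [set u | [&& u.1 \in P, u.2 \in P & key u.1 != key u.2]].

Lemma card_split_pairs (U V : finType) (P : {set U}) (key : U -> V) :
  (#|split_pairs P key| + \sum_v #|[set u in P | key u == v]| ^ 2 = #|P| ^ 2)%N.
Proof.
rewrite -[RHS]mulnn -cardsX -(cardsID [set u | key u.1 != key u.2] (setX P P)).
congr (_ + _)%N.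
  by apply: eq_card => u; rewrite !inE andbA.
rewrite (card_key_fibres _ (fun u => key u.1)); apply: eq_bigr => v _.
rewrite -mulnn -cardsX; apply: eq_card => -[a b]; rewrite !inE /= negbK.
case: (key a =P v) => [->|_]; rewrite ?andbF // [v == _]eq_sym.
by case: (a \in P); case: (b \in P); case: (key b == v).
Qed.

Section PatternTotals.
Variables (T X Y : finType) (rho : T -> X) (lam : T -> Y) (slot : pred Y).
Hypothesis slot2 : forall k, slot k -> #|[set c | lam c == k]| = 2%N.

(** Regrouping the coordinates of an ordered pattern separates the choice of rows from the choice of
    columns. *)
Lemma card_double_edges :
  (2 * #|double_edges rho lam| = #|same_pairs rho| * #|same_pairs lam|)%N.
Proof.
rewrite mulnC -card_par -cardsX.
pose f (z : (T * T) * (T * T)) := ((z.1.1, z.2.1), (z.1.2, z.2.2)).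
have f_inj : injective f by move=> [[? ?] [? ?]] [[? ?] [? ?]] [-> -> -> ->].
rewrite -(card_imset _ f_inj); apply: eq_card => -[[a b] [c e]].
apply/imsetP/idP => [[[[a' c'] [b' e']] + [-> -> -> ->]]|].
  by rewrite !inE /= /par => /and4P[/= -> -> -> ->].
rewrite !inE /= => /andP[/andP[h1 h2] /andP[h3 h4]].
by exists ((a, c), (b, e)); rewrite // !inE /par /= h1 h2 h3 h4.
Qed.

Lemma card_slot_pairs :
  #|[set z in same_pairs lam | slot (lam z.1)]| = (2 * #|slot|)%N.
Proof.
rewrite (card_key_fibres _ (fun z => lam z.1)) (bigID slot) /= [X in (_ + X)%N]big1 ?addn0.
  rewrite mulnC -sum_nat_const; apply: eq_bigr => k sk.
  transitivity #|[set z in same_pairs lam | lam z.1 == k]|.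
    by apply: eq_card => z; rewrite !inE; case: (lam z.1 =P k) => [->|]; rewrite ?sk ?andbF ?andbT.
  by rewrite card_same_pairs_fibre slot2.
move=> k /negPf nk; apply/eqP; rewrite cards_eq0; apply/eqP/setP => z; rewrite !inE.
by case: (lam z.1 =P k) => [->|]; rewrite ?nk ?andbF.
Qed.

Lemma card_twin_slots_total :
  (4 * #|twin_slots rho lam slot| = #|split_pairs (same_pairs rho) (fun z => rho z.1)|
     * (4 * #|slot| * (#|slot| - 1)))%N.
Proof.
pose SP := [set z in same_pairs lam | slot (lam z.1)].
(* Each slot has 2 ordered pairs of points, so the difference is
   [(2 * #|slot|) ^ 2 - 4 * #|slot|]. *)
have -> : (4 * #|slot| * (#|slot| - 1) = #|split_pairs SP (fun z => lam z.1)|)%N.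
  have := card_split_pairs SP (fun z => lam z.1); rewrite card_slot_pairs.
  have -> : (\sum_v #|[set u in SP | lam u.1 == v]| ^ 2 = 4 * #|slot|)%N.
    rewrite (bigID slot) /= [X in (_ + X)%N]big1 ?addn0.
      rewrite mulnC -sum_nat_const; apply: eq_bigr => k sk.
      have -> : #|[set u in SP | lam u.1 == k]| = #|[set z in same_pairs lam | lam z.1 == k]|.
        by apply: eq_card => z; rewrite !inE; case: (lam z.1 =P k) => [->|]; rewrite ?sk ?andbF ?andbT.
      by rewrite card_same_pairs_fibre slot2.
    move=> k /negPf nk; apply/eqP; rewrite expn_eq0 cards_eq0 andbT.
    apply/eqP/setP => z; rewrite !inE.
    by case: (lam z.1 =P k) => [->|]; rewrite ?nk ?andbF.
  by clear; set x := #|split_pairs _ _|; set m := #|slot|; nia.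
rewrite mulnC -card_quad -cardsX.
pose f (z : ((T * T) * (T * T)) * ((T * T) * (T * T))) :=
  (((z.1.1.1, z.2.1.1), (z.1.2.1, z.2.2.1)), ((z.1.1.2, z.1.2.2), (z.2.1.2, z.2.2.2))).
have f_inj : injective f.
  by move=> [[[? ?] [? ?]] [[? ?] [? ?]]] [[[? ?] [? ?]] [[? ?] [? ?]]] [-> -> -> -> -> -> -> ->].
rewrite -(card_imset _ f_inj); apply: eq_card => -[[[a b] [a' b']] [[c c'] [e e']]].
apply/imsetP/idP => [[[[[x1 y1] [x2 y2]] [[x3 y3] [x4 y4]]] + [-> -> -> -> -> -> -> ->]]|].
  rewrite !inE /= /quad.
  by case/and5P=> /= -> -> -> -> /and5P[-> -> -> -> /and4P[-> -> -> ->]].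
rewrite !inE /= => /andP[/and3P[/andP[h1 h2] /andP[h3 h4] h5] /and3P[/andP[/andP[h6 h7] h8] /andP[/andP[h9 h10] h11] h12]].
exists (((a, c), (a', c')), ((b, e), (b', e'))); rewrite // !inE /quad /=.
by rewrite h1 h2 h3 h4 h5 h6 h7 h8 h9 h10 h11 h12.
Qed.

End PatternTotals.

(** * From permutations to B-graphs *)

Lemma exists_labelling (X : finType) (m : X -> nat) (N : nat) :
  (\sum_x m x = N)%N -> exists f : 'I_N -> X, forall x, #|[set a | f a == x]| = m x.
Proof.
move=> mN; pose s := flatten [seq nseq (m x) x | x <- index_enum X].
have sN : size s == N.
  rewrite size_flatten /shape -map_comp sumnE big_map -mN.
  by apply/eqP/eq_bigr => x _ /=; rewrite size_nseq.
exists (tnth (Tuple sN)) => x.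
have -> : m x = count_mem x s.
  rewrite count_flatten -map_comp sumnE big_map (bigD1 x) //= count_nseq /= eqxx mul1n.
  by rewrite big1 ?addn0 // => y /negPf yx; rewrite /= count_nseq /= yx.
have -> : count_mem x s = count_mem x (map (tnth (Tuple sN)) (enum 'I_N)) by rewrite map_tnth_enum.
rewrite count_map -sum1_count big_enum_cond /=.
by rewrite -sum1_card; apply: eq_bigl => a; rewrite inE.
Qed.

Section CountingGraphs.
Variables (n : nat) (L R : {set 'I_n}) (d : 'I_n -> nat) (h : nat) (T : finType).
Variables (rho : T -> 'I_n) (lam : T -> 'I_n + 'I_h).
Hypothesis bip : bipartition L R.
Hypothesis hE : (M1 d L + h.*2 = M1 d R)%N.
Hypothesis rhoE : forall v, #|[set a | rho a == v]| = row_degree R d v.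
Hypothesis lamE : forall y, #|[set c | lam c == y]| = col_degree L d y.

Definition is_slot : pred ('I_n + 'I_h) := fun y => if y is inr _ then true else false.

Lemma card_slot_fibre k : is_slot k -> #|[set c | lam c == k]| = 2%N.
Proof. by case: k => // k _; rewrite lamE. Qed.

Lemma card_is_slot : #|is_slot| = h.
Proof.
rewrite -[RHS]card_ord -(card_imset predT (@inr_inj 'I_n 'I_h)).
by apply: eq_card => -[i|k]; rewrite ?imset_f //; apply/esym/negP => /imsetP[].
Qed.

Lemma bigraph_degrees (s : {perm T}) :
  [forall a, forall b, (rho a == rho b) && (lam (s a) == lam (s b)) ==> (a == b)] ->
  (forall v, #|[set y | (v, y) \in bigraph rho lam s]| = row_degree R d v) /\
  (forall y, #|nbr (bigraph rho lam s) y| = col_degree L d y).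
Proof.
move=> /'forall_forallP inj.
have {}inj a b : rho a = rho b -> lam (s a) = lam (s b) -> a = b.
  by move=> r l; have := inj a b; rewrite r l !eqxx => /eqP.
split=> [v|y].
  rewrite -rhoE -(@card_in_imset _ _ (fun a => lam (s a))); last first.
    by move=> a b; rewrite !inE => /eqP <- /eqP r; apply: inj.
  apply: eq_card => y; rewrite [LHS]inE; apply/imsetP/imsetP => [[a _ [-> ->]]|[a + ->]].
    by exists a; rewrite ?inE.
  by rewrite inE => /eqP <-; exists a.
rewrite -lamE -(card_imset _ (@perm_inj _ s^-1%g)).
rewrite -[RHS](@card_in_imset _ _ rho); last first.
  move=> _ _ /imsetP[c + ->] /imsetP[c' + ->]; rewrite !inE => /eqP hc /eqP hc' r.
  by apply: inj r _; rewrite !permKV hc hc'.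
apply: eq_card => x; apply/(mem_nbr rho lam)/imsetP => [[a <- la]|[_ /imsetP[c + ->] ->]].
  by exists a => //; apply/imsetP; exists (s a); rewrite ?inE ?la ?permK.
by rewrite inE => /eqP <-; exists ((s^-1)%g c); rewrite ?permKV.
Qed.

Lemma prod_degree_fact : ((\prod_v (row_degree R d v)`!) * (\prod_y (col_degree L d (h := h) y)`!)
  = 2 ^ h * \prod_(i < n) (d i)`!)%N.
Proof.
rewrite big_sumType /= big_const_ord iter_muln_1 mulnA mulnC; congr (_ * _)%N.
rewrite -big_split /=; apply: eq_bigr => i _; rewrite /row_degree.
case/andP: bip => dis /eqP cov; have : i \in L :|: R by rewrite cov inE.
rewrite inE; case iL : (i \in L) => /=; first by rewrite (disjointFr dis iL) mul1n.
by move=> ->; rewrite muln1.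
Qed.

Lemma card_avoiders_forbidden :
  #|avoiders (forbidden rho lam is_slot)| =
  (g L R d * (h`! * (2 ^ h * \prod_(i < n) (d i)`!)))%N.
Proof.
rewrite mulnA -(card_good_bigraphs bip hE) -prod_degree_fact.
rewrite -sum1_card (partition_big (bigraph rho lam) (mem (good_bigraphs L R d h))) /=; last first.
  move=> s; rewrite (mem_avoiders_forbidden rho card_slot_fibre) => /andP[inj /'forall_forallP tw].
  have [hr hc] := bigraph_degrees inj; rewrite inE; apply/and3P; split.
  - by apply/forallP => v; rewrite hr.
  - by apply/forallP => y; rewrite hc.
  - apply/'forall_forallP => k l; apply/implyP => kl.
    have /implyP := tw (inr k) (inr l); apply => /=.
    by apply: contra kl => /eqP -[->].
rewrite -sum_nat_const; apply: eq_bigr => B Bg.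
have := Bg; rewrite inE => /and3P[/forallP hr /forallP hc /'forall_forallP tw].
rewrite sum1_card.
under eq_bigr do rewrite -rhoE; under [X in (_ * X)%N]eq_bigr do rewrite -lamE.
rewrite -(@card_perm_bigraph _ _ _ rho lam B) => [|v|y]; last 2 first.
- by rewrite (eqP (hr v)) rhoE.
- by rewrite lamE -(eqP (hc y)).
apply: eq_card => s; rewrite [LHS]inE /= [RHS]inE (mem_avoiders_forbidden rho card_slot_fibre).
rewrite -andbA; congr andb; case: eqP => [->|]; rewrite ?andbF // andbT.
apply/'forall_forallP => -[i|k] -[i'|l]; rewrite ?andbF //=; apply/implyP => kl.
have /implyP := tw k l; apply.
by apply: contra kl => /eqP ->.
Qed.

End CountingGraphs.

(** * The asymptotic formula *)

Local Open Scope ring_scope.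

(** Here [A] and [ML] are [M2] of [R] and [L], [B] counts pairs of row pairs at a common vertex, and
    [x1], [x2] are the numbers of patterns of size 2 and 4. Thus [x1 / N ^ 2] is exactly
    [mu0 + mu1], while [x2 / N ^ 4] approximates [mu2]. The errors come from falling factorials in
    place of powers, from [h] against [h ^ 2], and from [B]. *)
Lemma close_mass (R : realFieldType) (N D A ML h B x1 x2 : R) :
  16 <= N -> 1 <= D -> 0 <= A <= N * D -> 0 <= ML <= N * D -> 0 <= h -> h <= h ^+ 2 ->
  2 * h <= N -> 0 <= B <= N * D ^+ 3 -> B <= A ^+ 2 ->
  2 * x1 = A * (ML + 2 * h) -> x2 = (A ^+ 2 - B) * (h ^+ 2 - h) ->
  `| x1 * (N * (N - 1))^-1 + x2 * (N * (N - 1) * (N - 2) * (N - 3))^-1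
     - (2 * h * A / (2 * N ^+ 2) + A * ML / (2 * N ^+ 2) + (2 * h * A / (2 * N ^+ 2)) ^+ 2) |
  <= 10 * (D ^+ 4 / N).
Proof.
move=> N16 D1 /andP[A0 AN] /andP[M0 MN] h0 hh hN /andP[B0 BN] BA x1E x2E.
have N0 : 0 < N by lra.
have Nn0 : N != 0 by rewrite gt_eqF.
pose u := N^-1; have u0 : 0 < u by rewrite invr_gt0.
have Nu : N * u = 1 by rewrite mulfV.
pose a := A * u; pose m := ML * u; pose k := h * u; pose b := B * u.
have a0 : 0 <= a by rewrite mulr_ge0 // ltW.
have m0 : 0 <= m by rewrite mulr_ge0 // ltW.
have k0 : 0 <= k by rewrite mulr_ge0 // ltW.
have b0 : 0 <= b by rewrite mulr_ge0 // ltW.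
have aD : a <= D by rewrite /a ler_pdivrMr // mulrC.
have mD : m <= D by rewrite /m ler_pdivrMr // mulrC.
have bD : b <= D ^+ 3 by rewrite /b ler_pdivrMr // mulrC.
have k2 : k <= 2^-1 by rewrite /k ler_pdivrMr //; lra.
have D2 : D <= D ^+ 2 by rewrite expr2 ler_peMr //; lra.
have D23 : D ^+ 2 <= D ^+ 3 by rewrite [leRHS]exprS ler_peMl // exprn_ge0 //; lra.
have D34 : D ^+ 3 <= D ^+ 4 by rewrite [leRHS]exprS ler_peMl // exprn_ge0 //; lra.
have D20 : 1 <= D ^+ 2 by lra.
pose y := a * (m + 2 * k) / 2.
have mk0 : 0 <= m + 2 * k by rewrite addr_ge0 // mulr_ge0.
have y0 : 0 <= y by rewrite divr_ge0 // mulr_ge0.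
have yD : y <= D ^+ 2.
  have : a * (m + 2 * k) <= D * (2 * D) by apply: ler_pM => //; lra.
  by rewrite /y; lra.
have ka : k ^+ 2 * a ^+ 2 <= D ^+ 2 / 4.
  have k4 : k ^+ 2 <= 4^-1.
    by have := ler_pM k0 k0 k2 k2; rewrite -expr2 => h'; apply: le_trans h' _; lra.
  have a4 : a ^+ 2 <= D ^+ 2 by rewrite ler_sqr ?nnegrE //; lra.
  have := ler_pM (sqr_ge0 _) (sqr_ge0 _) k4 a4.
  lra.
pose z := x2 * u ^+ 4.
have hh0 : 0 <= h ^+ 2 - h by rewrite subr_ge0.
have x20 : 0 <= x2 by rewrite x2E mulr_ge0 // subr_ge0.
have z0 : 0 <= z by rewrite mulr_ge0 // exprn_ge0 // ltW.
have zE : (k * a) ^+ 2 - z = u * (a ^+ 2 * k) + u * (b * (k ^+ 2 - u * k)).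
  rewrite /z x2E /k /a /b.
  have -> : u * (B * u * ((h * u) ^+ 2 - u * (h * u))) = B * (h ^+ 2 - h) * u ^+ 4 by ring.
  ring.
have bk : 0 <= b * (k ^+ 2 - u * k) <= D ^+ 3 / 4.
  have -> : k ^+ 2 - u * k = (h ^+ 2 - h) * u ^+ 2 by rewrite /k; ring.
  have e1 : 0 <= (h ^+ 2 - h) * u ^+ 2 by rewrite mulr_ge0 // exprn_ge0 // ltW.
  have e2 : (h ^+ 2 - h) * u ^+ 2 <= 4^-1.
    have e3 : (h ^+ 2 - h) * u ^+ 2 = k ^+ 2 - u * k by rewrite /k; ring.
    have : k ^+ 2 <= 4^-1.
      by have := ler_pM k0 k0 k2 k2; rewrite -expr2 => h'; apply: le_trans h' _; lra.
    have : 0 <= u * k by rewrite mulr_ge0 // ltW.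
    rewrite e3; lra.
  by rewrite mulr_ge0 //=; apply: ler_pM.
have ak : 0 <= a ^+ 2 * k <= D ^+ 2.
  rewrite mulr_ge0 ?sqr_ge0 //= -[leRHS]mulr1; apply: ler_pM; rewrite ?sqr_ge0 //; last lra.
  by rewrite ler_sqr ?nnegrE //; lra.
have zle : z <= D ^+ 2 / 4.
  apply: le_trans ka; rewrite -exprMn -subr_ge0 zE.
  by case/andP: bk => ? _; case/andP: ak => ? _; rewrite addr_ge0 // mulr_ge0 // ltW.
have p1 : x1 * (N * (N - 1))^-1 = y + y * (N - 1)^-1.
  have -> : x1 = A * (ML + 2 * h) / 2 by rewrite -x1E; field.
  rewrite /y /a /m /k /u; field; rewrite Nn0 /=; lra.
(* The quadratic in [N] is [N ^ 3 - (N - 1) * (N - 2) * (N - 3)]. *)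
have p2 : x2 * (N * (N - 1) * (N - 2) * (N - 3))^-1
    = z + z * (6 * N ^+ 2 - 11 * N + 6) * ((N - 1) * (N - 2) * (N - 3))^-1.
  rewrite /z /u; field; rewrite Nn0 /=; lra.
have p3 : 2 * h * A / (2 * N ^+ 2) + A * ML / (2 * N ^+ 2) = y.
  by rewrite /y /a /m /k /u; field.
have p4 : 2 * h * A / (2 * N ^+ 2) = k * a by rewrite /k /a /u; field.
rewrite p3 p1 p2 p4.
have -> : y + y * (N - 1)^-1 + (z + z * (6 * N ^+ 2 - 11 * N + 6) * ((N - 1) * (N - 2) * (N - 3))^-1)
    - (y + (k * a) ^+ 2) =
  y * (N - 1)^-1 + z * ((6 * N ^+ 2 - 11 * N + 6) * ((N - 1) * (N - 2) * (N - 3))^-1) - ((k * a) ^+ 2 - z).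
  by ring.
rewrite zE.
have q1 : 0 <= (N - 1)^-1 <= 2 * u.
  apply/andP; split; first by rewrite invr_ge0; lra.
  rewrite -[leLHS]mul1r ler_pdivrMr; last lra.
  have : 16 * u <= 1 by rewrite -[leRHS]Nu ler_pM2r.
  have -> : 2 * u * (N - 1) = 2 * (N * u) - 2 * u by ring.
  rewrite Nu; lra.
set P := (N - 1) * (N - 2) * (N - 3).
have P0 : 0 < P by rewrite !mulr_gt0 // subr_gt0; lra.
have q2 : 0 <= (6 * N ^+ 2 - 11 * N + 6) * P^-1 <= 12 * u.
  apply/andP; split.
    rewrite mulr_ge0 //; last by rewrite invr_ge0 ltW.
    nra.
  rewrite ler_pdivrMr // -(ler_pM2l N0).
  have -> : N * (12 * u * P) = 12 * P * (N * u) by ring.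
  rewrite Nu mulr1 /P; nra.
set v := (N - 1)^-1 in q1 *; set w := (_ * P^-1) in q2 *.
have t1 : 0 <= y * v <= 2 * (u * D ^+ 2).
  case/andP: q1 => v0 vu; rewrite mulr_ge0 //=.
  by have := ler_pM y0 v0 yD vu; have -> : D ^+ 2 * (2 * u) = 2 * (u * D ^+ 2) by ring.
have t2 : 0 <= z * w <= 3 * (u * D ^+ 2).
  case/andP: q2 => v0 vu; rewrite mulr_ge0 //=.
  by have := ler_pM z0 v0 zle vu; have -> : D ^+ 2 / 4 * (12 * u) = 3 * (u * D ^+ 2) by field.
have t3 : 0 <= u * (a ^+ 2 * k) <= u * D ^+ 2.
  by case/andP: ak => ? ?; rewrite mulr_ge0 ?(ltW u0) //= ler_pM2l.
have t4 : 0 <= u * (b * (k ^+ 2 - u * k)) <= u * D ^+ 3.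
  case/andP: bk => ? ?; rewrite mulr_ge0 ?(ltW u0) //= ler_pM2l //.
  have : 0 <= D ^+ 3 by rewrite exprn_ge0 //; lra.
  lra.
have t5 : u * D ^+ 2 <= u * D ^+ 4 by rewrite ler_pM2l //; lra.
have t6 : u * D ^+ 3 <= u * D ^+ 4 by rewrite ler_pM2l //; lra.
rewrite -/u [D ^+ 4 * u]mulrC ler_norml.
move: t1 t2 t3 t4 t5 t6.
move: (y * v) (z * w) (u * (a ^+ 2 * k)) (u * (b * _)) (u * D ^+ 2) (u * D ^+ 3) (u * D ^+ 4).
move=> T1 T2 T3 T4 T5 T6 T7 /andP[h1 h2] /andP[h3 h4] /andP[h5 h6] /andP[h7 h8] h9 h10.
apply/andP; split; lra.
Qed.

(* [16 * K * 20 ^ 2] bounds the local lemma error [K * eta * (16 * N * eta)] at [eta = 20 D^2 / N],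
   [K = 4 * 80 * 64]; the last [10] comes from [close_mass]. *)
Definition rate (F : realFieldType) : F := 16 * (4 * 80 * 64) * (20 * 20) + 10.

Lemma expR_sandwich (F : realType) (t x : F) : 0 <= t <= 2^-1 ->
  expR (- t) <= x <= expR t -> `|x - 1| <= 2 * t.
Proof.
move=> /andP[t0 t2] /andP[h1 h2].
have e1 := expR_ge1Dx (- t).
have e2 : expR t <= 1 + 2 * t.
  rewrite -[expR t]invrK -expRN; apply: (@le_trans _ _ (1 - t)^-1).
    rewrite lef_pV2 ?posrE ?expR_gt0 //; lra.
  rewrite -[leLHS]mul1r ler_pdivrMr; nra.
rewrite ler_norml; apply/andP; split; lra.
Qed.

(** * Application to a degree sequence *)

Section Assembly.
Variables (F : realType) (n : nat) (L R : {set 'I_n}) (d : 'I_n -> nat).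
Hypothesis bip : bipartition L R.
Hypothesis evenM : ~~ odd (M d).
Hypothesis LR : (M1 d L <= M1 d R)%N.
Let N := M1 d R.
Let D := dmax d.
Let h := ((M1 d R - M1 d L)./2)%N.

Lemma sum_parts (f : 'I_n -> nat) : (\sum_(i in L) f i + \sum_(i in R) f i = \sum_i f i)%N.
Proof.
case/andP: bip => dis /eqP cov.
rewrite [RHS](bigID (mem L)) /=; congr addn; apply: eq_bigl => i.
have : i \in L :|: R by rewrite cov inE.
rewrite inE; have [iL|iL] := boolP (i \in L); first by rewrite (disjointFr dis iL).
by move=> /= ->.
Qed.

Lemma M_parts : (M1 d L + M1 d R = M d)%N.
Proof. exact: sum_parts. Qed.

Lemma half_excess : (M1 d L + h.*2 = M1 d R)%N.
Proof.
rewrite /h halfK oddB // addbC -oddD M_parts (negPf evenM) subn0.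
by rewrite addnC subnK.
Qed.

Lemma d_le_dmax i : (d i <= D)%N.
Proof. exact: leq_bigmax. Qed.

Lemma row_labelling : exists rho : 'I_N -> 'I_n, forall v, #|[set a | rho a == v]| = row_degree R d v.
Proof. by apply: exists_labelling; rewrite /N /M1 [RHS]big_mkcond. Qed.

Lemma col_labelling : exists lam : 'I_N -> 'I_n + 'I_h,
  forall y, #|[set c | lam c == y]| = col_degree L d y.
Proof.
apply: exists_labelling; rewrite /N big_sumType /= -half_excess.
by congr addn; [rewrite /M1 [RHS]big_mkcond|rewrite sum_nat_const card_ord muln2].
Qed.

Lemma M2_le (S : {set 'I_n}) : (M2 d S <= M1 d S * D)%N.
Proof.
rewrite /M2 /M1 big_distrl /=; apply: leq_sum => i _; rewrite leq_mul2l.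
by rewrite (leq_trans (leq_subr _ _)) ?orbT // d_le_dmax.
Qed.

Section Labelled.
Variables (rho : 'I_N -> 'I_n) (lam : 'I_N -> 'I_n + 'I_h).
Hypothesis rhoE : forall v, #|[set a | rho a == v]| = row_degree R d v.
Hypothesis lamE : forall y, #|[set c | lam c == y]| = col_degree L d y.

Let FF := forbidden rho lam (@is_slot n h).

Lemma card_row_pairs : #|same_pairs rho| = M2 d R.
Proof.
rewrite card_same_pairs /M2 [RHS]big_mkcond /=; apply: eq_bigr => v _.
by rewrite rhoE /row_degree; case: ifP.
Qed.

Lemma card_col_pairs : #|same_pairs lam| = (M2 d L + 2 * h)%N.
Proof.
rewrite card_same_pairs big_sumType /=; congr addn.
  rewrite /M2 [RHS]big_mkcond /=; apply: eq_bigr => i _.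
  by rewrite lamE /=; case: ifP.
under eq_bigr do rewrite lamE /=.
by rewrite sum_nat_const card_ord mulnC.
Qed.

Lemma row_pair_squares :
  (\sum_v #|[set z in same_pairs rho | rho z.1 == v]| ^ 2 <= N * D ^ 3)%N.
Proof.
rewrite /N /M1 [X in (_ <= X * _)%N]big_mkcond big_distrl /=; apply: leq_sum => v _.
rewrite card_same_pairs_fibre rhoE /row_degree; case: ifP => // _.
have := d_le_dmax v; move: (d v) => x xD.
apply: (@leq_trans ((x * D) ^ 2)%N).
  by rewrite leq_exp2r // leq_mul2l (leq_trans (leq_subr _ _)) ?orbT.
by rewrite expnMn (expnS D 2) -mulnn -mulnA leq_mul2l leq_mul2r xD !orbT.
Qed.

Lemma forbidden_total : (4 <= N)%N -> \sum_(P in FF) pr F 'I_N #|P| =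
  #|double_edges rho lam|%:R * (N%:R * (N%:R - 1))^-1
  + #|twin_slots rho lam (@is_slot n h)|%:R * (N%:R * (N%:R - 1) * (N%:R - 2) * (N%:R - 3))^-1.
Proof.
move=> N4; have := @card_ord N => cT.
rewrite (eq_bigl [predU double_edges rho lam & twin_slots rho lam (@is_slot n h)]); last first.
  by move=> P; rewrite /FF !inE.
rewrite bigU /=; last first.
  rewrite disjoint_subset; apply/subsetP => P P2; apply/negP => P4.
  by have := card_double_edge P2; rewrite (card_twin_slots P4).
congr (_ + _).
  rewrite (eq_bigr (fun=> (N%:R * (N%:R - 1))^-1 : F)); first by rewrite sumr_const [RHS]mulr_natl.
  move=> P /card_double_edge ->; rewrite /pr cT !ffactnSr ffactn0 mul1n subn0.
  by rewrite natrM natrB //; lia.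
rewrite (eq_bigr (fun=> (N%:R * (N%:R - 1) * (N%:R - 2) * (N%:R - 3))^-1 : F)).
  by rewrite sumr_const [RHS]mulr_natl.
move=> P /card_twin_slots ->; rewrite /pr cT !ffactnSr ffactn0 mul1n subn0.
by rewrite !natrM !natrB //; lia.
Qed.

Lemma forbidden_total_close : (16 <= N)%N -> (0 < D)%N ->
  `|\sum_(P in FF) pr F 'I_N #|P| - (mu0 F L R d + mu1 F L R d + mu2 F L R d)|
  <= 10 * (D%:R ^+ 4 / N%:R).
Proof.
move=> N16 D0; rewrite forbidden_total; last by lia.
have sq := card_split_pairs (same_pairs rho) (fun z => rho z.1).
set B := (\sum_v _)%N in sq.
have x1 := card_double_edges rho lam.
have x2 := card_twin_slots_total rho (card_slot_fibre lamE).
rewrite card_is_slot in x2; rewrite card_row_pairs in sq x1; rewrite card_col_pairs in x1.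
have hN : (2 * h <= N)%N by rewrite /N -half_excess -mul2n leq_addl.
have -> : mu2 F L R d = mu0 F L R d ^+ 2 by [].
have -> : mu0 F L R d = 2 * h%:R * (M2 d R)%:R / (2 * N%:R ^+ 2).
  have NE : N%:R = (M1 d L)%:R + 2 * h%:R :> F.
    by rewrite /N -half_excess natrD -mul2n natrM.
  by rewrite /mu0 -/N; congr (_ * _ / _); rewrite NE addrC addKr.
rewrite /mu1 -/N.
apply: (@close_mass F N%:R D%:R (M2 d R)%:R (M2 d L)%:R h%:R B%:R).
- by rewrite (ler_nat _ 16).
- by rewrite ler1n.
- by rewrite ler0n -natrM ler_nat M2_le.
- rewrite ler0n -natrM ler_nat /=; apply: leq_trans (M2_le L) _.
  by rewrite leq_mul2r /N LR orbT.
- by [].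
- by rewrite -natrX ler_nat; case: (h) => // k; rewrite leq_pmulr.
- by rewrite -natrM ler_nat.
- by rewrite ler0n -natrX -natrM ler_nat row_pair_squares.
- by rewrite -natrX ler_nat -sq leq_addl.
- by rewrite -!natrM -natrD -natrM x1.
have -> : (M2 d R)%:R ^+ 2 - B%:R = #|split_pairs (same_pairs rho) (fun z => rho z.1)|%:R :> F.
  by rewrite -natrX -sq natrD addrK.
have -> : h%:R ^+ 2 - h%:R = (h * (h - 1))%:R :> F.
  by case: (h) => [|k]; rewrite ?mul0n ?expr0n ?subrr // subn1 natrM -natrX expnS expn1 natrM -[k.+1.-1]/k -natr1; ring.
apply: (@mulfI _ 4); first by rewrite pnatr_eq0.
by rewrite -!natrM x2 !mulnA; congr (_%:R); lia.
Qed.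

Lemma fibre_le_dmax v : (#|[set a | rho a == v]| <= D)%N.
Proof. by rewrite rhoE /row_degree; case: ifP => // _; apply: d_le_dmax. Qed.

Lemma fibre_le_double_dmax y : (0 < D)%N -> (#|[set c | lam c == y]| <= 2 * D)%N.
Proof.
move=> D0; rewrite lamE; case: y => [i|k] /=; last by rewrite leq_pmulr.
case: ifP => // _; apply: leq_trans (d_le_dmax i) _.
by rewrite leq_pmull.
Qed.

Lemma main_termE : main_term F L R d * (h`! * (2 ^ h * \prod_(i < n) (d i)`!))%:R
  = (N`!)%:R * expR (- (mu0 F L R d + mu1 F L R d + mu2 F L R d)).
Proof.
have -> : (h`! * (2 ^ h * \prod_(i < n) (d i)`!))%:R
    = 2 ^+ h * (h`!)%:R * \prod_(i < n) ((d i)`!)%:R :> F.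
  by rewrite natrM natrM natrX natr_prod mulrCA mulrA.
rewrite /main_term /= -/h -/N !opprD divfK //.
rewrite !mulf_neq0 // ?expf_neq0 ?pnatr_eq0 -?lt0n ?fact_gt0 //.
by apply/prodf_neq0 => i _; rewrite pnatr_eq0 -lt0n fact_gt0.
Qed.

Lemma avoiders_close : (0 < D)%N -> rate F * (D%:R ^+ 4 / N%:R) <= 2^-1 -> (0 < N)%N ->
  (N`!)%:R * expR (- (mu0 F L R d + mu1 F L R d + mu2 F L R d))
    * expR (- (rate F * (D%:R ^+ 4 / N%:R))) <= #|avoiders FF|%:R
  <= (N`!)%:R * expR (- (mu0 F L R d + mu1 F L R d + mu2 F L R d))
    * expR (rate F * (D%:R ^+ 4 / N%:R)).
Proof.
move=> D0 t_small N0.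
have Np : 0 < N%:R :> F by rewrite ltr0n.
have D1 : 1 <= D%:R :> F by rewrite ler1n.
have D2 : 1 <= D%:R ^+ 2 :> F by rewrite exprn_ege1.
have D24 : D%:R ^+ 2 <= D%:R ^+ 4 :> F.
  by rewrite (exprD _ 2 2) ler_peMl // exprn_ge0.
have rD : rate F * D%:R ^+ 4 <= 2^-1 * N%:R by rewrite -ler_pdivrMr // -mulrA.
have r0 : 64 * 16 * 20 <= rate F by rewrite /rate; lra.
(* Since [D >= 1], the smallness of the error term already makes [N] large. *)
have N16 : (16 <= N)%N.
  rewrite -(ler_nat F); apply: le_trans (_ : 2 * (rate F * D%:R ^+ 4) <= _); last by lra.
  have : rate F * 1 <= rate F * D%:R ^+ 4 by rewrite ler_pM2l; lra.
  by rewrite mulr1; lra.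
pose eta : F := 20 * (D ^ 2)%:R * N%:R^-1.
have etaE : N%:R * eta = 20 * D%:R ^+ 2 by rewrite /eta mulrC mulfVK ?natrX // gt_eqF.
have eta_small : 64 * 16 * eta <= 1.
  rewrite -(ler_pM2l Np) mulr1 mulrCA etaE.
  have : (64 * 16 * 20) * D%:R ^+ 2 <= rate F * D%:R ^+ 4 by apply: ler_pM.
  lra.
have cT := card_ord N.
have [lo up] : (((#|'I_N|)`!)%:R * expR (- ((1 + 4 * 80 * 64 * eta) * \sum_(P in FF) pr F 'I_N #|P|))
    <= #|avoiders FF|%:R) /\
  (#|avoiders FF|%:R <= ((#|'I_N|)`!)%:R * expR (- ((1 - 4 * 80 * 64 * eta) * \sum_(P in FF) pr F 'I_N #|P|))).
  apply/andP; apply: avoiders_bounds => //; first by rewrite cT.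
  - exact: card_forbidden.
  - exact: compat_forbidden.
  - exact: forbidden_antichain.
  - move=> Q Q0; rewrite /eta -[N in X in _ <= X]cT.
    apply: forbidden_sparse => //; first exact: card_slot_fibre.
      exact: fibre_le_dmax.
    by move=> y; apply: fibre_le_double_dmax.
have tot : \sum_(P in FF) pr F 'I_N #|P| <= 16 * (N%:R * eta).
  rewrite -[N in X in _ <= X]cT; apply: sum_pr_le; first by rewrite cT.
  - exact: card_forbidden.
  - move=> Q Q0; rewrite /eta -[N in X in _ <= X]cT.
    apply: forbidden_sparse => //; first exact: card_slot_fibre.
      exact: fibre_le_dmax.
    by move=> y; apply: fibre_le_double_dmax.
have close := forbidden_total_close N16 D0.
rewrite cT in lo up; set s := \sum_(P in FF) _ in lo up tot close.
set mu := mu0 F L R d + mu1 F L R d + mu2 F L R d in close *.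
have eta0 : 0 <= eta by rewrite !mulr_ge0 // invr_ge0 ltW.
have s_err : 4 * 80 * 64 * eta * s <= 16 * (4 * 80 * 64) * (20 * 20) * (D%:R ^+ 4 / N%:R).
  apply: (@le_trans _ _ (4 * 80 * 64 * eta * (16 * (N%:R * eta)))).
    by rewrite ler_wpM2l // mulr_ge0.
  rewrite etaE /eta natrX le_eqVlt; apply/orP; left; apply/eqP.
  have -> : D%:R ^+ 4 = D%:R ^+ 2 * D%:R ^+ 2 :> F by rewrite -exprD.
  ring.
have tE : rate F * (D%:R ^+ 4 / N%:R) = 16 * (4 * 80 * 64) * (20 * 20) * (D%:R ^+ 4 / N%:R) + 10 * (D%:R ^+ 4 / N%:R).
  by rewrite /rate mulrDl.
move: close; rewrite ler_norml => /andP[c1 c2].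
apply/andP; split.
  apply: le_trans lo; rewrite -[leLHS]mulrA ler_wpM2l // -expRD ler_expR tE.
  move: s_err c2; rewrite mulrDl mul1r; lra.
apply: le_trans up _; rewrite -[leRHS]mulrA ler_wpM2l // -expRD ler_expR tE.
move: s_err c1; rewrite mulrBl mul1r; lra.
Qed.

End Labelled.

Lemma half_M_le : (M d)%:R <= 2 * N%:R :> F.
Proof. by rewrite -natrM ler_nat -M_parts /N mul2n -addnn leq_add2r. Qed.

Lemma g_approx : (0 < D)%N -> rate F * (D%:R ^+ 4 / N%:R) <= 2^-1 -> (0 < N)%N ->
  exists2 delta : F, `|delta| <= 2 * (rate F * (D%:R ^+ 4 / N%:R)) &
    (g L R d)%:R = main_term F L R d * (1 + delta).
Proof.
move=> D0 t_small N0; have [rho rhoE] := row_labelling; have [lam lamE] := col_labelling.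
have := avoiders_close rhoE lamE D0 t_small N0.
rewrite (card_avoiders_forbidden bip half_excess rhoE lamE) -main_termE (natrM _ (g L R d)).
set w := (_ * (2 ^ _ * _))%:R.
set t := rate F * _ in t_small *; rewrite /=.
have w0 : 0 < w.
  rewrite /w ltr0n !muln_gt0 fact_gt0 expn_gt0 /= prodn_gt0 // => i.
  exact: fact_gt0.
have m0 : 0 < main_term F L R d.
  rewrite -(pmulr_lgt0 _ w0) main_termE mulr_gt0 ?expR_gt0 // ltr0n fact_gt0 //.
move=> /andP[lo up]; exists ((g L R d)%:R / main_term F L R d - 1); last first.
  by rewrite addrC subrK mulrC divfK // gt_eqF.
apply: expR_sandwich.
  rewrite t_small andbT mulr_ge0 // ?divr_ge0 // ?exprn_ge0 //.
  by rewrite /rate; lra.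
rewrite ler_pdivlMr // ler_pdivrMr // -(ler_pM2r w0) -[X in _ && X](ler_pM2r w0).
by apply/andP; split; [rewrite -[leLHS]mulrA [leLHS]mulrC|rewrite -[leRHS]mulrA [leRHS]mulrC].
Qed.

(** For [d = 0] the error bound is 0, by the convention [x / 0 = 0], so an exact equality is
    required. *)
Lemma g_edgeless : (forall i, d i = 0%N) -> (g L R d)%:R = main_term F L R d.
Proof.
move=> d0; have [rho rhoE] := row_labelling; have [lam lamE] := col_labelling.
have N0 : N = 0%N by rewrite /N /M1 big1.
have c0 : #|'I_N| = 0%N by rewrite card_ord.
have f0 : forbidden rho lam (@is_slot n h) = finset.set0.
  apply/setP => P; rewrite [RHS]inE; apply/negP => /card_forbidden /andP[+ _].
  by apply/negP; rewrite -ltnNge; apply: leq_ltn_trans (max_card _) _; rewrite card_prod c0.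
have := card_avoiders_forbidden bip half_excess rhoE lamE.
rewrite f0 avoiders_set0 c0 fact0 => /esym/eqP; rewrite muln_eq1 => /andP[/eqP -> /eqP W1].
have := main_termE; rewrite W1 mulr1 => ->.
have M20 : M2 d R = 0%N by rewrite /M2 big1 // => i _; rewrite d0.
by rewrite N0 fact0 /mu2 /mu1 /mu0 M20 !(mulr0, mul0r) expr0n /= !addr0 oppr0 expR0 mulr1.
Qed.

End Assembly.

Local Open Scope classical_set_scope.

Theorem theorem2p1 (F : realType) (f : nat -> F) (hf : f @ \oo --> (0 : F)) :
  exists C : F, \forall n \near \oo,
    forall (L R : {set 'I_n}) (d : 'I_n -> nat),
      bipartition L R ->
      ~~ odd (M d) ->
      (dmax d)%:R <= f n * (M d)%:R `^ (4^-1) ->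
      (M1 d L <= M1 d R)%N ->
      exists2 delta : F,
        `|delta| <= C * ((dmax d)%:R ^+ 4 / (M d)%:R) &
        (g L R d)%:R = main_term F L R d * (1 + delta).
Proof.
have r1 : 1 <= rate F by rewrite /rate; lra.
(* Chosen so that [D ^ 4 / M <= c] and [M <= 2 * N] bring the error term of [g_approx] down to its
   threshold [1 / 2]. *)
pose c : F := (4 * rate F)^-1.
have c0 : 0 < c by rewrite invr_gt0; lra.
have c1 : c <= 1 by rewrite invf_le1; lra.
(* One factor 2 is lost in [g_approx], the other in replacing [N] by [M]. *)
exists (4 * rate F).
near=> n; move=> L R d bip ev dM LR.
have fc : `|f n| <= c by near: n; exact: cvgr0_norm_le.
have [D0|D0] := posnP (dmax d).
  have d0 i : d i = 0%N by apply/eqP; rewrite -leqn0 -D0 d_le_dmax.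
  exists 0; last by rewrite addr0 mulr1 (g_edgeless F bip ev LR d0).
  by rewrite normr0 D0 expr0n mul0r mulr0.
have M0 : (0 < M d)%N.
  rewrite lt0n; apply: contraTneq D0 => M0; rewrite -leqNgt.
  apply/bigmax_leqP => i _; rewrite -M0 /M (bigD1 i) //=.
  exact: leq_addr.
have Mp : 0 < (M d)%:R :> F by rewrite ltr0n.
(* The fourth power of the hypothesis gives [c ^ 4], which is at most [c]. *)
have D4 : (dmax d)%:R ^+ 4 <= c * (M d)%:R.
  have h : (dmax d)%:R <= c * (M d)%:R `^ (4^-1).
    apply: le_trans dM _; rewrite ler_wpM2r ?powR_ge0 //.
    exact: le_trans (ler_norm _) fc.
  have : (dmax d)%:R ^+ 4 <= (c * (M d)%:R `^ (4^-1)) ^+ 4 by rewrite lerXn2r ?nnegrE // mulr_ge0 ?powR_ge0 // ltW.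
  rewrite exprMn -[X in _ <= _ * X]powR_mulrn ?powR_ge0 // -powRrM mulVf // powRr1 //.
  move=> h4; apply: le_trans h4 _; rewrite ler_wpM2r //.
  by rewrite exprS ler_piMr ?exprn_ile1 // ltW.
have MN := half_M_le F bip LR.
have Np : 0 < (M1 d R)%:R :> F by lra.
have q : (dmax d)%:R ^+ 4 / (M1 d R)%:R <= 2 * ((dmax d)%:R ^+ 4 / (M d)%:R) :> F.
  rewrite mulrCA ler_wpM2l ?exprn_ge0 //.
  by rewrite -[leLHS]mul1r ler_pdivrMr // mulrAC ler_pdivlMr // mul1r.
have small : rate F * ((dmax d)%:R ^+ 4 / (M1 d R)%:R) <= 2^-1.
  have h : (dmax d)%:R ^+ 4 / (M d)%:R <= c by rewrite ler_pdivrMr.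
  have rc : rate F * c = 4^-1 by rewrite /c; field; lra.
  have rc2 : rate F * (2 * c) = 2^-1 by rewrite mulrCA rc; lra.
  by rewrite -rc2 ler_wpM2l //; lra.
have [|delta hdelta gE] := g_approx bip ev LR D0 small; first by rewrite -(ltr0n F).
exists delta => //; apply: le_trans hdelta _.
have : rate F * ((dmax d)%:R ^+ 4 / (M1 d R)%:R) <= rate F * (2 * ((dmax d)%:R ^+ 4 / (M d)%:R)).
  by rewrite ler_wpM2l //; lra.
lra.
Unshelve. all: by end_near. Qed.
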